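(* Let $(M,\mathcal I)$ and $(\bar M,\bar{\mathcal I})$ be two hyperbolic Euler-Lagrange systems. (A) If $(M,\mathcal I)$ and $(\bar M,\bar{\mathcal I})$ are related by a Type I special rank-$1$ Bäcklund transformation, then one of them is positive and the other is negative. (B) If $(M,\mathcal I)$ and $(\bar M,\bar{\mathcal I})$ are related by a Type III special rank-$1$ Bäcklund transformation, then they are not both degenerate.
   Context: **Hyperbolic Monge-Ampère systems.** A hyperbolic Monge-Ampère system $(M,\mathcal I)$ is a 5-manifold $M$ with a differential ideal $\mathcal I\subset\Omega^*(M)$ which is locally generated algebraically by a 1-form $\theta$ and 2-forms $d\theta,\Omega$ such that $\theta\wedge(d\theta)^2\neq 0$; $d\theta,\Omega$ are pointwise linearly independent modulo $\theta$; and $(\lambda d\theta+\mu\Omega)^2\equiv 0 \bmod \theta$ has exactly two distinct solutions $[\lambda:\mu]\in\mathbb{RP}^1$. Equivalently, locally $\mathcal I$ is algebraically generated by $\omega^0,\ \omega^1\wedge\omega^2,\ \omega^3\wedge\omega^4$ for some coframing $(\omega^0,\dots,\omega^4)$ with $\omega^0$ a contact form. **1-adapted coframings and invariants.** Such a local coframing is 1-adapted if $d\omega^0\equiv\omega^1\wedge\omega^2+\omega^3\wedge\omega^4 \bmod \omega^0$; $d\omega^1\equiv d\omega^2\equiv0\bmod\omega^0,\omega^1,\omega^2$; $d\omega^3\equiv d\omega^4\equiv 0\bmod\omega^0,\omega^3,\omega^4$. The values of 1-adapted coframings form a principal bundle $\mathcal G_1\to M$ with group $G_1\subset GL(5,\mathbb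 R)$ generated by $\mathrm{diag}(a;A;B)$, $A,B\in GL(2,\mathbb R)$, $a=\det A=\det B$, and by $J$, the matrix exchanging the index pairs $(1,2)$ and $(3,4)$. Functions $V_1,\dots,V_8$ on $\mathcal G_1$ are defined by $d\omega^1\equiv(V_1+V_5)\omega^0\wedge\omega^3+(V_2+V_6)\omega^0\wedge\omega^4$ and $d\omega^2\equiv(V_3+V_7)\omega^0\wedge\omega^3+(V_4+V_8)\omega^0\wedge\omega^4$, both mod $\omega^1,\omega^2$; $d\omega^3\equiv(V_8-V_4)\omega^0\wedge\omega^1+(V_2-V_6)\omega^0\wedge\omega^2$ and $d\omega^4\equiv(V_3-V_7)\omega^0\wedge\omega^1+(V_5-V_1)\omega^0\wedge\omega^2$, both mod $\omega^3,\omega^4$. Put $S_1=\begin{pmatrix} V_1 & V_2 \\ V_3 & V_4 \end{pmatrix}$, $S_2=\begin{pmatrix} V_5 & V_6 \\ V_7 & V_8 \end{pmatrix}$. For $(\bar M,\bar{\mathcal I})$ write $\bar{\mathcal G}_1,\bar S_1,\bar S_2$, with $\bar S_1=\begin{pmatrix} W_1 & W_2 \\ W_3 & W_4 \end{pmatrix}$. **Euler-Lagrange systems.** The system is called Euler-Lagrange if $S_2=0$. A hyperbolic Euler-Lagrange system is positive, negative, or degenerate according to whether $\det S_1>0$, $<0$, or $=0$ (the sign is independent of the 1-adapted coframing; each system considered is in exactly one of these classes). **Bäcklund transformations.** A rank-1 Bäcklund transformation relating $(M,\mathcal I)$ and $(\bar M,\bar{\mathcal I})$ (local generators $\theta,d\theta,\Omega$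 and $\bar\theta,d\bar\theta,\bar\Omega$) is an embedded 6-manifold $\phi:N\to M\times\bar M$ whose projections $\pi,\bar\pi$ to $M,\bar M$ are submersions with $\ker d\pi\cap\ker d\bar\pi=0$ and such that, modulo $\pi^*\theta,\bar\pi^*\bar\theta$, the subbundles of $\Lambda^2T^*N$ spanned by $\{\pi^*d\theta,\bar\pi^*d\bar\theta\}$ and by $\{\pi^*\Omega,\bar\pi^*\bar\Omega\}$ coincide. **Liftings.** Let $\alpha=(\alpha_0,\dots,\alpha_4)$, $\beta=(\beta_0,\dots,\beta_4)$ be the tautological 1-forms on $\mathcal G_1$, $\bar{\mathcal G}_1$, and let $\mathcal P$ be the set of $(u,\bar u,s,t,\mu,\epsilon)$ with $u\in\mathcal G_1$, $\bar u\in\bar{\mathcal G}_1$, $s,t\in\mathbb R^4$, $\mu\ge1$, $\epsilon=\pm1$, $\epsilon\mu^2\ne1$. Let $\mathcal J$ be the Pfaffian system on $\mathcal P$ generated by $\beta_i-s_i\alpha_0-t_i\beta_0-\mu\alpha_i$ $(i=1,2)$, $\beta_3-s_3\alpha_0-t_3\beta_0-\mu^{-1}\alpha_3$, $\beta_4-s_4\alpha_0-t_4\beta_0-\epsilon\mu^{-1}\alpha_4$, with independence condition $\alpha_1\wedge\alpha_2\wedge\alpha_3\wedge\alpha_4\wedge\alpha_0\wedge\beta_0\neq0$. A 0-refined lifting of $\phi$ is a lift $\hat\phi:N\to\mathcal P$ of $\phi$ that is an integral manifold of $\mathcal J$ satisfying the independence condition. The functions $\mu\circ\hat\phi$, $\epsilon\circ\hat\phi$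 depend only on $\phi$. A 1-refined lifting is a 0-refined lifting with image in the locus $\mathcal P_1=\{s_1=t_1=s_3=t_3=0,\ s_4=-t_4\mu^2,\ t_2=-\epsilon s_2\mu^2\}$. (After shrinking $N$, 1-refined liftings exist.) **Special transformations and their types.** A rank-1 Bäcklund transformation is special if $\mu=1$ (so $\epsilon=-1$). A special rank-1 Bäcklund transformation relating two hyperbolic Euler-Lagrange systems is said to be of Type I if $V_2=0$ and $\det S_1=V_1V_4\ne0$ on its 1-refined liftings; Type II if $V_2=0$ and $V_1V_4=0$; Type III if $V_2\neq0$ (conditions independent of the chosen 1-refined lifting). *)

(* Defs.v *)
(* Hyperbolic Monge-Ampere systems and rank-1 Backlund transformations between
   them, on abstract smooth manifolds. *)
From HB Require Import structures.
From mathcomp Require Import all_boot all_order all_algebra all_fingroup.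
From mathcomp Require Import all_classical all_reals all_analysis.

Set Implicit Arguments.
Unset Strict Implicit.
Unset Printing Implicit Defensive.

Import Order.TTheory GRing.Theory Num.Theory.
Import numFieldNormedType.Exports.

Local Open Scope classical_set_scope.
Local Open Scope ring_scope.

(* Iterated directional derivatives; in finite dimension and for A open this is
   the usual class C^k. *)
Fixpoint Ck (R : realType) (U V : normedModType R) (k : nat) (A : set U)
    (F : U -> V) : Prop :=
  match k with
  | 0 => forall x, A x -> {for x, continuous F}
  | k'.+1 => (forall x, A x -> differentiable F x) /\
             (forall v, Ck k' A ('D_v F))
  end.

Definition smooth_on (R : realType) (U V : normedModType R) (A : set U)
  (F : U -> V) : Prop := forall k, Ck k A F.

(* The charts form a smooth atlas, not assumed to be maximal.  [mcrd i] and
   [minv i] only matter on [mdom i] and on its image.  [chart_at] is an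
   arbitrary choice of a chart around each point.  Manifolds are nonempty. *)
Record manifold (R : realType) (n : nat) := Manifold {
  mcarrier :> topologicalType;
  chart : Type;
  mdom : chart -> set mcarrier;
  mcrd : chart -> mcarrier -> 'rV[R]_n;
  minv : chart -> 'rV[R]_n -> mcarrier;
  chart_at : mcarrier -> chart;
  mnonempty : [set: mcarrier] !=set0;
  mhausdorff : hausdorff_space mcarrier;
  mcountable : @second_countable mcarrier;
  mdom_open : forall i, open (mdom i);
  mimg_open : forall i, open (mcrd i @` mdom i);
  mcrdK : forall i p, mdom i p -> minv i (mcrd i p) = p;
  mcrd_continuous : forall i, {within mdom i, continuous (mcrd i)};
  minv_continuous : forall i, {within mcrd i @` mdom i, continuous (minv i)};
  mem_chart_at : forall p, mdom (chart_at p) p;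
  mtrans_smooth : forall i j,
    smooth_on (mcrd i @` (mdom i `&` mdom j)) (mcrd j \o minv i)
}.

Arguments chart {R n} m.

Section Pointwise.
Variables (R : realType) (n : nat).

(* A k-covector on R^n is an alternating multilinear function of k vectors, the
   rows of a k x n matrix. *)
Definition alternating k (w : 'M[R]_(k, n) -> R) : Prop :=
  (forall (A B C : 'M[R]_(k, n)) (i : 'I_k) (b c : R),
     row i A = b *: row i B + c *: row i C ->
     row' i B = row' i A -> row' i C = row' i A ->
     w A = b * w B + c * w C) /\
  (forall (A : 'M[R]_(k, n)) (i j : 'I_k),
     i != j -> row i A = row j A -> w A = 0).

(* Normalized so that (a /\ b)(X, Y) = a(X) b(Y) - a(Y) b(X) for 1-covectors. *)
Definition wedge k l (a : 'M[R]_(k, n) -> R) (b : 'M[R]_(l, n) -> R)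
    (v : 'M[R]_(k + l, n)) : R :=
  (k`! * l`!)%:R^-1 *
  \sum_(s : 'S_(k + l))
     (-1) ^+ s * (a (usubmx (row_perm s v)) * b (dsubmx (row_perm s v))).

(* w1 = w2 modulo the algebraic ideal generated by the 1-covectors in s. *)
Definition congruent (s : seq ('M[R]_(1, n) -> R)) k
    (w1 w2 : 'M[R]_(k.+1, n) -> R) : Prop :=
  exists eta : 'I_(size s) -> 'M[R]_(k, n) -> R,
    (forall j, alternating (eta j)) /\
    forall v : 'M[R]_(k.+1, n),
      w1 v - w2 v = \sum_(j < size s) wedge (nth (fun=> 0) s j) (eta j) v.

End Pointwise.

Section Forms.
Variables (R : realType) (n : nat) (M : manifold R n).

(* A k-covector at a point is given by its expression in each chart around that
   point; a k-form is a field of such.  The values in charts that do not contain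
   the point are irrelevant. *)
Definition covector k := chart M -> 'M[R]_(k, n) -> R.
Definition form k := M -> covector k.

Definition is_covector k (p : M) (w : covector k) : Prop :=
  forall i, mdom i p ->
    alternating (w i) /\
    forall j, mdom j p ->
      forall v, w i v = w j (v *m jacobian (mcrd j \o minv i) (mcrd i p)).

Definition is_form k (U : set M) (w : form k) : Prop :=
  (forall p, U p -> is_covector p (w p)) /\
  forall i v, smooth_on (mcrd i @` (mdom i `&` U)) (fun x => w (minv i x) i v).

Definition eq_on k (U : set M) (w1 w2 : form k) : Prop :=
  forall p i, U p -> mdom i p -> forall v, w1 p i v = w2 p i v.

Definition form0 k : form k := fun _ _ _ => 0.
Definition formD k (w1 w2 : form k) : form k :=
  fun p i v => w1 p i v + w2 p i v.
Definition formW k l (w1 : form k) (w2 : form l) : form (k + l) :=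
  fun p i => wedge (w1 p i) (w2 p i).

(* Exterior derivative: the invariant formula applied, in each chart, to
   constant vector fields. *)
Definition extd k (w : form k) : form k.+1 :=
  fun p i (v : 'M[R]_(k.+1, n)) =>
    \sum_(j < k.+1)
      (-1) ^+ j *
      'D_(row j v) (fun x : 'rV[R]_n => w (minv i x) i (row' j v)) (mcrd i p).

Definition graded_set := forall k, set (form k).

(* (Homogeneous) algebraic ideals of Omega^*(U). *)
Definition is_ideal (U : set M) (J : graded_set) : Prop :=
  [/\ forall k (w : form k), J k w -> is_form U w,
      forall k (w w' : form k),
        J k w -> is_form U w' -> eq_on U w w' -> J k w',
      forall k, J k (@form0 k),
      forall k (w w' : form k), J k w -> J k w' -> J k (formD w w')
    & forall k l (w : form k) (eta : form l), J k w -> is_form U eta ->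
        J (k + l)%N (formW w eta) /\ J (l + k)%N (formW eta w)].

Definition is_differential_ideal (I : graded_set) : Prop :=
  is_ideal setT I /\ forall k (w : form k), I k w -> I k.+1 (extd w).

Definition locally_in (I : graded_set) (U : set M) k (w : form k) : Prop :=
  forall p, U p -> exists W : set M, exists w' : form k,
    [/\ open W, W p, I k w' & eq_on (U `&` W) w' w].

(* The restriction of I to U is algebraically generated by the 1-form th and
   the 2-forms Phi, Psi. *)
Definition generated (I : graded_set) (U : set M)
    (th : form 1) (Phi Psi : form 2) : Prop :=
  [/\ is_form U th, is_form U Phi, is_form U Psi,
      [/\ locally_in I U th, locally_in I U Phi & locally_in I U Psi]
    & forall k (w : form k), I k w ->
        forall J, is_ideal U J -> J 1%N th -> J 2%N Phi -> J 2%N Psi -> J k w].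

Definition contact (U : set M) (th : form 1) : Prop :=
  forall p i, U p -> mdom i p ->
    exists v, formW th (formW (extd th) (extd th)) p i v <> 0.

End Forms.

Section Maps.
Variables (R : realType) (n m : nat) (N : manifold R n) (M : manifold R m).

Definition smooth_map (f : N -> M) : Prop :=
  continuous f /\
  forall a i, smooth_on (mcrd a @` (mdom a `&` f @^-1` mdom i))
                        (mcrd i \o f \o minv a).

(* The tangent map of f at q, acting on row vectors, in the chart a at q and in
   the chosen chart at f q. *)
Definition tangent (f : N -> M) (q : N) (a : chart N) : 'M[R]_(n, m) :=
  jacobian (mcrd (chart_at (f q)) \o f \o minv a) (mcrd a q).

Definition pullback (f : N -> M) (q : N) k (w : covector M k) : covector N k :=
  fun a v => w (chart_at (f q)) (v *m tangent f q a).

(* Smoothness over W of a covector field along f. *)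
Definition smooth_along (f : N -> M) (W : set N) k (w : N -> covector M k) :=
  forall a i v,
    smooth_on (mcrd a @` (mdom a `&` W `&` f @^-1` mdom i))
              (fun y => w (minv a y) i v).

Definition smooth_fun (W : set N) (V : normedModType R) (g : N -> V) : Prop :=
  forall a, smooth_on (mcrd a @` (mdom a `&` W)) (g \o minv a).

End Maps.

Section MongeAmpere.
Variables (R : realType) (M : manifold R 5).
Implicit Types (I : graded_set M) (U : set M).

(* The two roots in RP^1 are [a.1 : a.2] and [b.1 : b.2]; the equivalence also
   holds trivially for l = m = 0. *)
Definition MA_generators I U (th : form M 1) (Om : form M 2) : Prop :=
  [/\ open U, generated I U th (extd th) Om, contact U th
    & forall p i, U p -> mdom i p ->
        let t := th p i in
        let pencil (l m : R) := l \*o extd th p i \+ m \*o Om p i in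
        (forall l m, congruent [:: t] (pencil l m) (fun=> 0) ->
           l = 0 /\ m = 0) /\
        exists a b : R * R,
          a.1 * b.2 - a.2 * b.1 <> 0 /\
          forall l m,
            congruent (k := 3) [:: t] (wedge (pencil l m) (pencil l m)) (fun=> 0)
            <-> l * a.2 = m * a.1 \/ l * b.2 = m * b.1].

Definition hyperbolic_MA I : Prop :=
  is_differential_ideal I /\
  forall p : M, exists U th Om, U p /\ MA_generators I U th Om.

(* In 'I_5 and 'I_2 the numerals below are the ordinals with these values. *)
Definition adapted_coframing I U (w : 'I_5 -> form M 1) : Prop :=
  [/\ open U, forall j, is_form U (w j),
      generated I U (w 0) (formW (w 1) (w 2)) (formW (w 3) (w 4)),
      contact U (w 0)
    & forall p i, U p -> mdom i p ->
        let e j := w j p i in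
        let de j := extd (w j) p i in
        [/\ forall v, (forall j, e j v = 0) -> v = 0,
            congruent [:: e 0] (de 0) (wedge (e 1) (e 2) \+ wedge (e 3) (e 4)),
            congruent [:: e 0; e 1; e 2] (de 1) (fun=> 0) /\
            congruent [:: e 0; e 1; e 2] (de 2) (fun=> 0)
          & congruent [:: e 0; e 3; e 4] (de 3) (fun=> 0) /\
            congruent [:: e 0; e 3; e 4] (de 4) (fun=> 0)]].

(* S1 = (V1, V2; V3, V4) and S2 = (V5, V6; V7, V8) are the values at p of the
   invariants of the 1-adapted coframing w. *)
Definition invariants (w : 'I_5 -> form M 1) (p : M) (S1 S2 : 'M[R]_2) : Prop :=
  forall i, mdom i p ->
    let e j := w j p i in
    let de j := extd (w j) p i in
    let comb x a y b := x \*o wedge (e 0) (e a) \+ y \*o wedge (e 0) (e b) in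
    let V1 := S1 0 0 in let V2 := S1 0 1 in
    let V3 := S1 1 0 in let V4 := S1 1 1 in
    let V5 := S2 0 0 in let V6 := S2 0 1 in
    let V7 := S2 1 0 in let V8 := S2 1 1 in
    [/\ congruent [:: e 1; e 2] (de 1) (comb (V1 + V5) 3 (V2 + V6) 4),
        congruent [:: e 1; e 2] (de 2) (comb (V3 + V7) 3 (V4 + V8) 4),
        congruent [:: e 3; e 4] (de 3) (comb (V8 - V4) 1 (V2 - V6) 2)
      & congruent [:: e 3; e 4] (de 4) (comb (V3 - V7) 1 (V5 - V1) 2)].

Definition extends_coframe I U (w : 'I_5 -> form M 1) (p : M)
    (u : 'I_5 -> covector M 1) : Prop :=
  [/\ adapted_coframing I U w, U p
    & forall j i, mdom i p -> forall v, w j p i v = u j i v].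

(* [G1 I p u]: the coframe u of T_p M belongs to the bundle of values of
   1-adapted coframings.  [V_at I p u S1 S2]: moreover the functions V_1..V_8
   take at u the values recorded in S1, S2. *)
Definition G1 I (p : M) (u : 'I_5 -> covector M 1) : Prop :=
  exists U w, extends_coframe I U w p u.

Definition V_at I (p : M) (u : 'I_5 -> covector M 1) (S1 S2 : 'M[R]_2) : Prop :=
  exists U w, extends_coframe I U w p u /\ invariants w p S1 S2.

Definition euler_lagrange I : Prop :=
  hyperbolic_MA I /\ forall p u S1 S2, V_at I p u S1 S2 -> S2 = 0.

Definition positive I : Prop :=
  forall p u S1 S2, V_at I p u S1 S2 -> 0 < \det S1.
Definition negative I : Prop :=
  forall p u S1 S2, V_at I p u S1 S2 -> \det S1 < 0.
Definition degenerate I : Prop :=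
  forall p u S1 S2, V_at I p u S1 S2 -> \det S1 = 0.

(* At most one of these holds, since G_1 is nonempty. *)
Definition has_class I : Prop := [\/ positive I, negative I | degenerate I].

End MongeAmpere.

Section Backlund.
Variables (R : realType) (M Mb : manifold R 5).
Variables (I : graded_set M) (Ib : graded_set Mb).
Variables (N : manifold R 6) (phi : N -> M * Mb).

Let pi : N -> M := fst \o phi.
Let pib : N -> Mb := snd \o phi.

Definition embedding_into_product : Prop :=
  [/\ smooth_map pi, smooth_map pib, injective phi,
      forall V : set N, open V ->
        exists W : set (M * Mb), open W /\ V = phi @^-1` W
    & forall q a, mdom a q -> forall v : 'rV[R]_6,
        v *m tangent pi q a = 0 -> v *m tangent pib q a = 0 -> v = 0].

(* The local generators Om, Omb are only determined up to adding multiples of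
   the other generators, so the condition is that they can be chosen to make
   the two subbundles coincide.  Injectivity of d(phi), in
   [embedding_into_product], is the condition on the kernels of the
   projections. *)
Definition backlund : Prop :=
  [/\ embedding_into_product,
      forall q a, mdom a q ->
        row_full (tangent pi q a) /\ row_full (tangent pib q a)
    & forall q0 : N, exists U Ub th Om thb Omb,
        [/\ U (pi q0), Ub (pib q0), MA_generators I U th Om,
            MA_generators Ib Ub thb Omb
          & forall q a, U (pi q) -> Ub (pib q) -> mdom a q ->
              let pb k (w : form M k) := pullback pi q (w (pi q)) a in
              let pbb k (w : form Mb k) := pullback pib q (w (pib q)) a in
              let spanned (w1 w2 : 'M[R]_(2, 6) -> R) :=
                [set w | alternating w /\ exists x y : R,
                   congruent [:: pb 1%N th; pbb 1%N thb] w (x \*o w1 \+ y \*o w2)] in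
              spanned (pb 2%N (extd th)) (pbb 2%N (extd thb)) =
              spanned (pb 2%N Om) (pbb 2%N Omb)]].

(* A map N -> P covering phi.  s and t have coordinates s_1, .., s_4 and
   t_1, .., t_4 in positions 0, .., 3. *)
Record lift := Lift {
  lift_u : N -> 'I_5 -> covector M 1;
  lift_ub : N -> 'I_5 -> covector Mb 1;
  lift_s : N -> 'rV[R]_4;
  lift_t : N -> 'rV[R]_4;
  lift_mu : N -> R;
  lift_eps : N -> R
}.

(* The pull-backs of the tautological forms by a lift. *)
Definition lift_alpha (L : lift) (q : N) (j : 'I_5) : covector N 1 :=
  pullback pi q (lift_u L q j).
Definition lift_beta (L : lift) (q : N) (j : 'I_5) : covector N 1 :=
  pullback pib q (lift_ub L q j).

Definition smooth_lift (W : set N) (L : lift) : Prop :=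
  [/\ forall j, smooth_along pi W (fun q => lift_u L q j),
      forall j, smooth_along pib W (fun q => lift_ub L q j),
      smooth_fun W (lift_s L) /\ smooth_fun W (lift_t L),
      smooth_fun W (lift_mu L : N -> R^o)
    & smooth_fun W (lift_eps L : N -> R^o)].

Definition in_P (L : lift) (q : N) : Prop :=
  [/\ G1 I (pi q) (lift_u L q), G1 Ib (pib q) (lift_ub L q), 1 <= lift_mu L q,
      lift_eps L q = 1 \/ lift_eps L q = -1 & lift_eps L q * lift_mu L q ^+ 2 <> 1].

Definition integral_of_J (L : lift) (q : N) : Prop :=
  forall a, mdom a q ->
    let al j := lift_alpha L q j a in
    let be j := lift_beta L q j a in
    let s := lift_s L q 0 in let t := lift_t L q 0 in
    let mu := lift_mu L q in let eps := lift_eps L q in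
    [/\ forall v, be 1 v - s 0 * al 0 v - t 0 * be 0 v - mu * al 1 v = 0,
        forall v, be 2 v - s 1 * al 0 v - t 1 * be 0 v - mu * al 2 v = 0,
        forall v, be 3 v - s 2 * al 0 v - t 2 * be 0 v - mu^-1 * al 3 v = 0
      & forall v,
          be 4 v - s 3 * al 0 v - t 3 * be 0 v - eps * mu^-1 * al 4 v = 0].

Definition independent (L : lift) (q : N) : Prop :=
  forall a, mdom a q ->
    let al j := lift_alpha L q j a in
    exists v, wedge (wedge (wedge (wedge (wedge (al 1) (al 2)) (al 3)) (al 4))
                       (al 0)) (lift_beta L q 0 a) v <> 0.

(* Liftings defined over an open subset W of N. *)
Definition lifting0 (W : set N) (L : lift) : Prop :=
  [/\ open W, smooth_lift W L
    & forall q, W q -> [/\ in_P L q, integral_of_J L q & independent L q]].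

Definition in_P1 (L : lift) (q : N) : Prop :=
  let s := lift_s L q 0 in let t := lift_t L q 0 in
  let mu := lift_mu L q in let eps := lift_eps L q in
  [/\ s 0 = 0 /\ t 0 = 0, s 2 = 0 /\ t 2 = 0,
      s 3 = - t 3 * mu ^+ 2 & t 1 = - eps * s 1 * mu ^+ 2].

Definition lifting1 (W : set N) (L : lift) : Prop :=
  lifting0 W L /\ forall q, W q -> in_P1 L q.

(* A condition "on the liftings" of phi: since liftings exist only after
   shrinking N, it bears on all those defined over open subsets, and there is
   at least one over some nonempty open subset. *)
Definition on_liftings (lifting : set N -> lift -> Prop)
    (C : lift -> N -> Prop) : Prop :=
  (exists W L, W !=set0 /\ lifting W L) /\
  forall W L, lifting W L -> forall q, W q -> C L q.

Definition special : Prop := on_liftings lifting0 (fun L q => lift_mu L q = 1).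

Definition on_invariants (C : 'M[R]_2 -> Prop) : Prop :=
  on_liftings lifting1
    (fun L q => forall S1 S2, V_at I (pi q) (lift_u L q) S1 S2 -> C S1).

Definition type_I : Prop :=
  special /\
  on_invariants (fun S1 => let V1 := S1 0 0 in let V2 := S1 0 1 in
                           let V4 := S1 1 1 in
                           [/\ V2 = 0, \det S1 = V1 * V4 & V1 * V4 <> 0]).

Definition type_III : Prop :=
  special /\ on_invariants (fun S1 => let V2 := S1 0 1 in V2 <> 0).

End Backlund.

(* Main.v *)
(* Write al_j, be_j for the pull-backs to N of the coframes of a 1-refined
   lifting of a special transformation (mu = 1, eps = -1).  Then
     be_1 = al_1,  be_2 = al_2 + s (al_0 + be_0),
     be_3 = al_3,  be_4 = - al_4 + t (be_0 - al_0).
   Let V, W be the matrices S_1 of the two systems.  Comparing d(be_1) with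
   d(al_1) on ker(al_1, al_2, al_0 + be_0) and d(be_3) with d(al_3) on
   ker(al_3, al_4, be_0 - al_0) gives W_1 = - V_1, W_2 = V_2, W_4 = V_4, and
   V_2 = 0 as soon as s t = 0.  The identity d(d(al_0)) = 0 expresses the
   al_3-component of the connection form of al_0 as a trace, and the same holds
   for be_0; comparing the two traces and then d(be_2) with d(al_2) gives
   W_3 = - V_3 - 2 s t.  Hence det W = - det V + 2 s t V_2, and both parts follow.

   The al_j are not pull-backs of forms on M, since the lifting varies with the
   point of N.  Near a given point they differ from the pull-backs of a
   1-adapted coframing by a block-diagonal gauge transformation equal to 1 at
   that point, which does not affect the derivatives on the relevant kernels.
   The block structure is read off the integral elements of the ideal. *)
Require Import Defs.
From mathcomp Require Import all_boot all_order all_algebra all_fingroup.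
From mathcomp Require Import all_classical all_reals all_analysis.
From mathcomp Require Import ring lra.
(* Imported again because mathcomp shadows [alternating]. *)
Require Import Defs.

Set Implicit Arguments.
Unset Strict Implicit.
Unset Printing Implicit Defensive.

Import Order.TTheory GRing.Theory Num.Theory.
Import numFieldNormedType.Exports.

Local Open Scope classical_set_scope.
Local Open Scope ring_scope.

(** * Smooth functions *)

(** Everything is evaluated at one point of a 1-refined lifting. The classes are global and
    [has_class] is assumed, so one value of each determinant decides between them. The obstacle is
    that [G1] extends each value of the lifting to some 1-adapted coframing, with no regularity of
    this choice from point to point. The lifting is therefore compared with one fixed coframing
    through an explicit matrix of continuous functions. At each nearby point this matrix is also the
    transition matrix to whatever extension exists there, which gives its block form. The form is
    needed on a whole neighbourhood, since it is differentiated; it holds there because the matrix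
    is the identity at the centre, which excludes the exchange J nearby. The entry W_3 is the hard
    one: d(be_2) brings in s (d(al_0) + d(be_0)), evaluated on a vector where neither al_0 nor be_0
    vanishes, so the congruence for the contact forms says nothing. The trace relations supply
    exactly these components, and they cancel. What survives is 2 s t: a correction by 2 t times the
    dual vector of al_4 is needed to stay in the kernel of be_4, and d(al_0) equals 1 on the dual
    vectors of al_3 and al_4. *)

Section Smooth.
Variables (R : realType) (U : normedModType R).

(** The difference [G - F] vanishes near [x], so it has the zero map as differential; adding it to
    [F] gives [G]. *)
Lemma near_differentiable (V : normedModType R) (F G : U -> V) x :
  {near x, F =1 G} -> differentiable F x -> differentiable G x.
Proof.
move=> FG dF.
have -> : G = F + (G - F) by apply/funext => y; rewrite !fctE addrC subrK.
apply: differentiableD => //.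
set H := G - F.
have H0 : \forall y \near x, H y = 0.
  by near=> y; rewrite /H !fctE (near FG y) ?subrr//.
have Hx : H x = 0 by exact: nbhs_singleton H0.
have cst0 : continuous (\0 : {linear U -> V}) by move=> y; exact: cvg_cst.
have E : H \o shift x = cst (H x) + (\0 : {linear U -> V}) +o_ 0 id.
  apply/eqaddoP => _/posnumP[e]; rewrite Hx.
  have : \forall y \near (0 : U), H (y + x) = 0.
    by move: H0; rewrite (near_shift 0) /= subr0.
  apply: filterS => y Hy.
  by rewrite !fctE /= Hy /= addr0 subrr normr0.
apply/diff_locallyP; split; first by rewrite (diff_unique cst0 E).
by rewrite (diff_unique cst0 E).
Unshelve. all: by end_near. Qed.

Lemma Ck_ext (V : normedModType R) k (A : set U) (F G : U -> V) :
  open A -> (forall x, A x -> F x = G x) -> Ck k A F -> Ck k A G.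
Proof.
move=> oA; elim: k F G => [|k IH] F G FG /=.
  move=> cF x Ax; have nFG : {near x, F =1 G}.
    by near=> y; apply: FG; near: y; exact: open_nbhs_nbhs.
  rewrite /prop_for /continuous_at -(nbhs_singleton nFG).
  apply: cvg_trans (cF x Ax); apply: near_eq_cvg.
  by near=> y; apply: (near nFG y).
move=> [dF CF]; have nFG x : A x -> {near x, F =1 G}.
  by move=> Ax; near=> y; apply: FG; near: y; exact: open_nbhs_nbhs.
split=> [x Ax|v]; first by apply: near_differentiable (nFG x Ax) (dF x Ax).
apply: (IH ('D_v F)) => // x Ax.
by apply: near_eq_derive; exact: nFG.
Unshelve. all: by end_near. Qed.

Lemma Ck_sub (V : normedModType R) k (A B : set U) (F : U -> V) :
  B `<=` A -> Ck k A F -> Ck k B F.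
Proof.
move=> BA; elim: k F => [|k IH] F /=; first by move=> cF x /BA; exact: cF.
by move=> [dF CF]; split=> [x /BA|v]; [exact: dF|exact/IH/CF].
Qed.

(** The recursive clause of [Ck] constrains derivatives only, so monotonicity in the order needs an
    induction. The Leibniz rule in [CkM] requires it for the undifferentiated factors. *)
Lemma CkW (V : normedModType R) k (A : set U) (F : U -> V) :
  Ck k.+1 A F -> Ck k A F.
Proof.
elim: k F => [|k IH] F /=.
  by move=> [dF _] x Ax; apply: differentiable_continuous; exact: dF.
by move=> [dF CF]; split=> // v; apply: IH; exact: CF.
Qed.

Lemma Ck_cst (V : normedModType R) k (A : set U) (c : V) : Ck k A (cst c : U -> V).
Proof.
elim: k c => [|k IH] c /=; first by move=> x _; exact: cvg_cst.
split=> // v.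
have -> : 'D_v (cst c) = cst 0 :> (U -> V) by apply/funext => x; rewrite derive_cst.
exact: IH.
Qed.

Lemma CkD (V : normedModType R) k (A : set U) (F G : U -> V) :
  open A -> Ck k A F -> Ck k A G -> Ck k A (fun x => F x + G x).
Proof.
move=> oA; elim: k F G => [|k IH] F G /=.
  by move=> cF cG x Ax; apply: cvgD; [exact: cF|exact: cG].
move=> [dF CF] [dG CG]; split=> [x Ax|v].
  by apply: differentiableD; [exact: dF|exact: dG].
apply: (@Ck_ext _ _ _ (fun x => 'D_v F x + 'D_v G x)) => //; last exact: IH.
move=> x Ax; rewrite -deriveD //; first exact/diff_derivable/dF.
exact/diff_derivable/dG.
Qed.

Lemma CkM k (A : set U) (F G : U -> R) :
  open A -> Ck k A F -> Ck k A G -> Ck k A (fun x => F x * G x).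
Proof.
move=> oA; elim: k F G => [|k IH] F G.
  by move=> cF cG x Ax; apply: cvgM; [exact: cF|exact: cG].
move=> CkF CkG; have [dF CF] := CkF; have [dG CG] := CkG; split=> [x Ax|v].
  by apply: differentiableM; [exact: dF|exact: dG].
apply: (@Ck_ext _ _ _ (fun x => F x * 'D_v G x + G x * 'D_v F x)) => //.
  move=> x Ax; rewrite -[RHS]/('D_v (F * G) x) deriveM //; first exact/diff_derivable/dF.
  exact/diff_derivable/dG.
apply: CkD => //; apply: IH => //; [exact: CkW CkF|exact: CG|exact: CkW CkG|exact: CF].
Qed.

Lemma smooth_ext (V : normedModType R) (A : set U) (F G : U -> V) :
  open A -> (forall x, A x -> F x = G x) -> smooth_on A F -> smooth_on A G.
Proof. by move=> oA FG sF k; apply: Ck_ext FG (sF k). Qed.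

Lemma smooth_sub (V : normedModType R) (A B : set U) (F : U -> V) :
  B `<=` A -> smooth_on A F -> smooth_on B F.
Proof. by move=> BA sF k; apply: Ck_sub BA (sF k). Qed.

Lemma smooth_diff (V : normedModType R) (A : set U) (F : U -> V) x :
  smooth_on A F -> A x -> differentiable F x.
Proof. by move=> /(_ 1%N)[dF _]; exact: dF. Qed.

Lemma smooth_derive (V : normedModType R) (A : set U) (F : U -> V) v :
  smooth_on A F -> smooth_on A ('D_v F).
Proof. by move=> sF k; have [_] := sF k.+1; exact. Qed.

Lemma smooth_derivable (V : normedModType R) (A : set U) (F : U -> V) x v :
  smooth_on A F -> A x -> derivable F x v.
Proof. by move=> sF Ax; apply/diff_derivable/(smooth_diff sF). Qed.

Lemma smooth_continuous (V : normedModType R) (A : set U) (F : U -> V) x :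
  smooth_on A F -> A x -> {for x, continuous F}.
Proof. by move=> sF Ax; apply: differentiable_continuous; exact: smooth_diff sF Ax. Qed.

Lemma smooth_cst (V : normedModType R) (A : set U) (c : V) :
  smooth_on A (fun=> c : V).
Proof. by move=> k; exact: Ck_cst. Qed.

Lemma smoothD (V : normedModType R) (A : set U) (F G : U -> V) :
  open A -> smooth_on A F -> smooth_on A G -> smooth_on A (fun x => F x + G x).
Proof. by move=> oA sF sG k; apply: CkD. Qed.

Lemma smoothM (A : set U) (F G : U -> R) :
  open A -> smooth_on A F -> smooth_on A G -> smooth_on A (fun x => F x * G x).
Proof. by move=> oA sF sG k; apply: CkM. Qed.

Lemma smooth_sum (A : set U) (J : Type) (r : seq J) (F : J -> U -> R) :
  open A -> (forall j, smooth_on A (F j)) ->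
  smooth_on A (fun x => \sum_(j <- r) F j x).
Proof.
move=> oA sF; elim: r => [|j r IH].
  by apply: smooth_ext (smooth_cst _ (0 : R)) => // x _; rewrite big_nil.
apply: (@smooth_ext _ _ (fun x => F j x + \sum_(j <- r) F j x)) => //.
  by move=> x _; rewrite big_cons.
exact: smoothD.
Qed.

Lemma smooth_coord m n (A : set U) (F : U -> 'M[R]_(m, n)) i j :
  open A -> smooth_on A F -> smooth_on A (fun x => F x i j : R).
Proof.
move=> oA sF k; elim: k F sF => [|k IH] F sF.
  move=> x Ax; apply: (@continuous_comp _ _ _ F (fun M : 'M[R]_(m, n) => M i j)).
    exact: smooth_continuous sF Ax.
  exact: coord_continuous.
split=> [x Ax|v].
  apply: (@differentiable_comp _ _ _ _ F (fun M : 'M[R]_(m, n) => M i j : R^o)).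
    exact: smooth_diff sF Ax.
  exact: differentiable_coord.
apply: (@Ck_ext _ _ _ (fun x => 'D_v F x i j)) => //; last exact/IH/smooth_derive.
move=> x Ax; rewrite derive_mx ?mxE //; exact: smooth_derivable sF Ax.
Qed.

End Smooth.

(** * Symmetry of second derivatives *)

Section Schwarz.
Variables (R : realType) (U : normedModType R).

Lemma is_derive_line (F : U -> R) (z w : U) (t : R) :
  derivable F (t *: w + z) w ->
  is_derive t (1 : R) (fun r : R => F (r *: w + z) : R) ('D_w F (t *: w + z)).
Proof.
have E : (fun h : R => h^-1 *:
      (((fun r : R => F (r *: w + z)) \o shift t) (h *: (1 : R)) - F (t *: w + z)))
   = (fun h : R => h^-1 *: ((F \o shift (t *: w + z)) (h *: w) - F (t *: w + z))).
  by apply/funext => h /=; rewrite [_%:A]mulr1 scalerDl addrA.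
by move=> dF; split; rewrite /derivable /derive E.
Qed.

(** Two applications of the mean value theorem, first along [v] and then along [w], turn the second
    difference into h^2 times the mixed derivative at a point of the small parallelogram; continuity
    of that derivative at [x] bounds the error. *)
Lemma second_difference (A : set U) (F : U -> R) (x v w : U) (e : R) :
  open A -> A x -> smooth_on A F -> 0 < e ->
  \forall h \near 0^'+,
    `| F (h *: v + (h *: w + x)) - F (h *: v + x) - (F (h *: w + x) - F x)
       - h ^+ 2 * 'D_w ('D_v F) x | <= e * h ^+ 2.
Proof.
move=> oA Ax sF e0.
have sv := smooth_derive v sF; have svw := smooth_derive w sv.
have cvw := smooth_continuous svw Ax.
have [r /= r0 Br] : exists2 r : R, 0 < r & forall z, `|x - z| < r ->
    A z /\ `|'D_w ('D_v F) x - 'D_w ('D_v F) z| <= e.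
  have : \forall z \near x, A z /\ `|'D_w ('D_v F) x - 'D_w ('D_v F) z| <= e.
    near=> z; split; first by near: z; exact: open_nbhs_nbhs.
    by near: z; move/cvgrPdist_le: cvw; exact.
  by move=> /nbhs_ballP[r r0 Br]; exists r => // z xz; apply: Br; rewrite -ball_normE.
near=> h.
have h0 : 0 < h by near: h; exact: nbhs_right_gt.
(* This keeps the whole parallelogram in the ball of radius [r]; the summand 1 keeps the divisor
   positive when [v = w = 0]. *)
have hr : h * (`|v| + `|w| + 1) < r.
  rewrite -ltr_pdivlMr; last by rewrite ltr_wpDl // addr_ge0.
  by near: h; apply: nbhs_right_lt; rewrite divr_gt0 // ltr_wpDl // addr_ge0.
have inB s t : 0 <= s <= h -> 0 <= t <= h -> `|x - (s *: v + (t *: w + x))| < r.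
  move=> /andP[s0 sh] /andP[t0 th]; apply: le_lt_trans hr.
  rewrite addrA opprD [- x]lock addrCA -lock subrr addr0 normrN.
  apply: le_trans (ler_normD _ _) _; rewrite !normrZ !ger0_norm //.
  rewrite mulrDr mulr1 mulrDr -[leLHS]addr0 lerD ?(ltW h0) //.
  by apply: lerD; apply: ler_wpM2r.
pose g (s : R) : R := F (s *: v + (h *: w + x)) - F (s *: v + x).
have hh : 0 <= h <= h by rewrite lexx ltW.
have h00 : 0 <= (0 : R) <= h by rewrite lexx ltW.
have inB0 s : 0 <= s <= h -> `|x - (s *: v + x)| < r.
  by move=> /inB /(_ h00); rewrite scale0r add0r.
have dg (s : R) : s \in `[0, h] ->
    is_derive s (1 : R) g ('D_v F (s *: v + (h *: w + x)) - 'D_v F (s *: v + x)).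
  rewrite in_itv /= => s01; apply: is_deriveB; apply: is_derive_line.
    by apply: smooth_derivable sF _; have [] := Br _ (inB _ _ s01 hh).
  by apply: smooth_derivable sF _; have [] := Br _ (inB0 _ s01).
have [c cI gc] := MVT h0 (fun s si => dg s (subset_itv_oo_cc si))
   (derivable_within_continuous (fun s si => ex_derive (is_derive := dg s si))).
have /andP[c0 ch] : 0 <= c <= h.
  by move: cI; rewrite in_itv /= => /andP[/ltW -> /ltW ->].
pose k (s : R) : R := 'D_v F (s *: w + (c *: v + x)).
have dk (s : R) : s \in `[0, h] ->
    is_derive s (1 : R) k ('D_w ('D_v F) (s *: w + (c *: v + x))).
  rewrite in_itv /= => s01; apply: is_derive_line.
  apply: smooth_derivable sv _; rewrite addrCA; have [] // := Br _ (inB c s _ s01).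
  by rewrite c0.
have [d dI kd] := MVT h0 (fun s si => dk s (subset_itv_oo_cc si))
   (derivable_within_continuous (fun s si => ex_derive (is_derive := dk s si))).
have d01 : 0 <= d <= h.
  by move: dI; rewrite in_itv /= => /andP[/ltW -> /ltW ->].
have -> : F (h *: v + (h *: w + x)) - F (h *: v + x) - (F (h *: w + x) - F x) =
    h ^+ 2 * 'D_w ('D_v F) (c *: v + (d *: w + x)).
  rewrite -[LHS]/(g h - (F (h *: w + x) - F x)).
  have -> : F (h *: w + x) - F x = g 0 by rewrite /g scale0r !add0r.
  rewrite gc subr0 addrCA -/(k h).
  have -> : 'D_v F (c *: v + x) = k 0 by rewrite /k scale0r !add0r.
  by rewrite kd subr0 (addrCA (d *: w)); ring.
rewrite -mulrBr normrM ger0_norm ?exprn_ge0 ?(ltW h0)// mulrC.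
apply: ler_wpM2r; first by rewrite exprn_ge0 ?(ltW h0).
rewrite distrC; have [] // := Br _ (inB c d _ d01); by rewrite c0.
Unshelve. all: by end_near. Qed.

(** The second difference is symmetric in [v] and [w], and for a common small [h] it approximates
    each mixed derivative times h^2 within e/2 times h^2. *)
Lemma derive_comm (A : set U) (F : U -> R) (x v w : U) :
  open A -> A x -> smooth_on A F -> 'D_w ('D_v F) x = 'D_v ('D_w F) x.
Proof.
move=> oA Ax sF; apply/eqP; rewrite -subr_eq0 -normr_le0; apply/ler_addgt0Pr => e e0; rewrite add0r.
have e20 : 0 < e / 2 by rewrite divr_gt0.
have P' := second_difference v w oA Ax sF e20.
have Q' := second_difference w v oA Ax sF e20.
have [h [h0 [P Q]]] := filter_ex (filterI (nbhs_right_gt 0) (filterI P' Q')).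
have h20 : 0 < h ^+ 2 by rewrite exprn_gt0.
rewrite -(ler_pM2r h20) -[X in _ * X <= _](ger0_norm (ltW h20)) -normrM.
have -> : e * h ^+ 2 = e / 2 * h ^+ 2 + e / 2 * h ^+ 2 by field.
apply: le_trans (lerD Q P).
rewrite [h *: w + (h *: v + x)]addrCA; apply: le_trans (ler_normB _ _).
rewrite le_eqVlt; apply/orP; left; apply/eqP; congr `|_|.
move: ('D_w ('D_v F) x) ('D_v ('D_w F) x) (F _) (F _) (F _) (F _).
by move=> a b c d e' e''; ring.
Qed.

End Schwarz.

(** * Continuity, 1-forms and their pull-backs *)

Section Continuity.
Variables (R : realType) (T : topologicalType).

Lemma sum_continuous_at (J : finType) (P : pred J) (F : J -> T -> R) x :
  (forall j, {for x, continuous (F j)}) ->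
  {for x, continuous (fun y => \sum_(j | P j) F j y)}.
Proof. by move=> cF; apply: cvg_big => [|j _]; [exact: add_continuous|exact: cF]. Qed.

Lemma prod_continuous_at (J : finType) (P : pred J) (F : J -> T -> R) x :
  (forall j, {for x, continuous (F j)}) ->
  {for x, continuous (fun y => \prod_(j | P j) F j y)}.
Proof. by move=> cF; apply: cvg_big => [|j _]; [exact: mul_continuous|exact: cF]. Qed.

Lemma det_continuous n (A : T -> 'M[R]_n) x :
  (forall i j, {for x, continuous (fun y => A y i j)}) ->
  {for x, continuous (fun y => \det (A y))}.
Proof.
move=> cA; apply: sum_continuous_at => s; apply: cvgM; first exact: cvg_cst.
by apply: prod_continuous_at => i; exact: cA.
Qed.

Lemma invmx_continuous n (A : T -> 'M[R]_n) x :
  A x \in unitmx -> (forall i j, {for x, continuous (fun y => A y i j)}) ->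
  forall i j, {for x, continuous (fun y => invmx (A y) i j)}.
Proof.
move=> uA cA i j.
have cdet := det_continuous cA.
have dx0 : \det (A x) != 0 by rewrite -unitfE -unitmxE.
have cadj : {for x, continuous (fun y => \adj (A y) i j)}.
  have -> : (fun y => \adj (A y) i j) = (fun y => cofactor (A y) j i).
    by apply/funext => y; rewrite mxE.
  apply: cvgM; first exact: cvg_cst.
  apply: (@det_continuous _ (fun y => row' j (col' i (A y)))) => k l.
  have -> : (fun y => row' j (col' i (A y)) k l) =
      (fun y => A y (fintype.lift j k) (fintype.lift i l)).
    by apply/funext => y; rewrite !mxE.
  exact: cA.
have H : {for x, continuous (fun y => (\det (A y))^-1 * \adj (A y) i j)}.
  by apply: cvgM => //; apply: cvgV.
rewrite /prop_for /continuous_at; rewrite /invmx uA [X in _ --> X]mxE.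
apply: cvg_trans H; apply: near_eq_cvg.
(* [invmx] returns its argument on singular matrices, so the adjugate formula is valid only where
   the determinant is nonzero. *)
have : \forall y \near x, \det (A y) != 0.
  have := cdet => /cvgr_neq0; apply.
  exact: dx0.
apply: filterS => y dy; by rewrite /invmx unitmxE unitfE dy [RHS]mxE.
Qed.

Lemma mulmx_continuous m n p (A : T -> 'M[R]_(m, n)) (B : T -> 'M[R]_(n, p)) x :
  (forall i j, {for x, continuous (fun y => A y i j)}) ->
  (forall i j, {for x, continuous (fun y => B y i j)}) ->
  forall i j, {for x, continuous (fun y => (A y *m B y) i j)}.
Proof.
move=> cA cB i j.
have -> : (fun y => (A y *m B y) i j) = (fun y => \sum_k A y i k * B y k j).
  by apply/funext => y; rewrite mxE.
by apply: sum_continuous_at => k; apply: cvgM; [exact: cA|exact: cB].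
Qed.

End Continuity.

Section WeakLeibniz.
Variables (R : realType) (U : normedModType R).

(* Only continuity of the coefficients [g j] is needed, since the [m j] vanish
   at [x]. *)
Lemma derive_sum_null (J : finType) (P : pred J) (g m : J -> U -> R) x Y :
  (forall j, P j -> {for x, continuous (g j)}) -> (forall j, P j -> m j x = 0) ->
  (forall j, P j -> derivable (m j) x Y) ->
  'D_Y (fun z => \sum_(j | P j) g j z * m j z) x =
  \sum_(j | P j) g j x * 'D_Y (m j) x.
Proof.
move=> cg m0 dm; apply: cvg_lim => //.
have -> : (fun h : R => h^-1 *:
      (((fun z => \sum_(j | P j) g j z * m j z) \o shift x) (h *: Y)
    - \sum_(j | P j) g j x * m j x : R)) =
  (fun h : R => \sum_(j | P j)
      g j (h *: Y + x) * (h^-1 *: ((m j \o shift x) (h *: Y) - m j x))).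
  apply/funext => h /=; rewrite [X in _ - X]big1 ?subr0 => [|j Pj]; last first.
    by rewrite m0 // mulr0.
  by rewrite scaler_sumr; apply: eq_bigr => j Pj; rewrite m0 // subr0 [LHS]mulrCA.
apply: cvg_big => [|j Pj]; first exact: add_continuous.
apply: cvgM; last exact: dm.
apply: (@cvg_comp _ _ _ (fun h : R => h *: Y + x) (g j) _ (nbhs x)); last exact: cg.
have -> : nbhs x = nbhs ((0 : R) *: Y + x) by rewrite scale0r add0r.
apply: cvgD; last exact: cvg_cst.
have H : (fun h : R => h *: Y) @ (0 : R) --> (0 : R) *: Y by exact: scalel_continuous.
by apply: cvg_trans H; apply: cvg_app; exact: cvg_within.
Qed.

End WeakLeibniz.

Section OneForms.
Variable R : realType.

Definition islin n (c : 'rV[R]_n -> R) : Prop :=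
  forall a b x y, c (a *: x + b *: y) = a * c x + b * c y.

Lemma islin0 n (c : 'rV[R]_n -> R) : islin c -> c 0 = 0.
Proof. by move=> /(_ 0 0 0 0); rewrite !scale0r addr0 !mul0r addr0. Qed.

Lemma islinZ n (c : 'rV[R]_n -> R) a x : islin c -> c (a *: x) = a * c x.
Proof. by move=> lc; have := lc a 0 x 0; rewrite scale0r !addr0 mul0r addr0. Qed.

Lemma islinD n (c : 'rV[R]_n -> R) x y : islin c -> c (x + y) = c x + c y.
Proof. by move=> /(_ 1 1 x y); rewrite !scale1r !mul1r. Qed.

Lemma islin_sum n (c : 'rV[R]_n -> R) (J : Type) (r : seq J) (F : J -> 'rV[R]_n) :
  islin c -> c (\sum_(j <- r) F j) = \sum_(j <- r) c (F j).
Proof.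
move=> lc; elim: r => [|j r IH]; first by rewrite !big_nil islin0.
by rewrite !big_cons islinD // IH.
Qed.

Lemma islin_basis n (c : 'rV[R]_n -> R) v : islin c ->
  c v = \sum_l c (delta_mx 0 l) * v 0 l.
Proof.
move=> lc; rewrite {1}(row_sum_delta v) islin_sum //.
by apply: eq_bigr => l _; rewrite islinZ // mulrC.
Qed.

(* The coordinate expression of the exterior derivative of a 1-form. *)
Definition dcf n (w : 'rV[R]_n -> 'rV[R]_n -> R) x X Y : R :=
  'D_X (w^~ Y) x - 'D_Y (w^~ X) x.

Lemma dcf_near n (w w' : 'rV[R]_n -> 'rV[R]_n -> R) x X Y :
  (\forall z \near x, w z = w' z) -> dcf w x X Y = dcf w' x X Y.
Proof.
move=> ww; rewrite /dcf; congr (_ - _); apply: near_eq_derive;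
by apply: filterS ww => z ->.
Qed.

Lemma dcf_anti n (w : 'rV[R]_n -> 'rV[R]_n -> R) x X Y : dcf w x X Y = - dcf w x Y X.
Proof. by rewrite /dcf opprB. Qed.

Lemma dcf_islin n (w : 'rV[R]_n -> 'rV[R]_n -> R) x X :
  (forall v, differentiable (w^~ v) x) -> (\forall z \near x, islin (w z)) ->
  islin (dcf w x X).
Proof.
move=> dw lw a b Y Z; rewrite /dcf.
have -> : 'D_X (w^~ (a *: Y + b *: Z)) x = a * 'D_X (w^~ Y) x + b * 'D_X (w^~ Z) x.
  have -> : 'D_X (w^~ (a *: Y + b *: Z)) x = 'D_X (a *: w^~ Y + b *: w^~ Z) x.
    by apply: near_eq_derive; apply: filterS lw => z lz; exact: lz.
  have d1 := diff_derivable (v := X) (dw Y).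
  have d2 := diff_derivable (v := X) (dw Z).
  by rewrite (deriveD (derivableZ (k := a) d1) (derivableZ (k := b) d2)) !deriveZ.
have -> : 'D_(a *: Y + b *: Z) (w^~ X) x = a * 'D_Y (w^~ X) x + b * 'D_Z (w^~ X) x.
  by rewrite !(deriveE _ (dw X)) linearD !linearZ.
move: ('D_X _ x) ('D_X _ x) ('D_Y _ x) ('D_Z _ x) => c d e f; ring.
Qed.

Variables (n m : nat) (A : set 'rV[R]_n) (B : set 'rV[R]_m).
Variables (f : 'rV[R]_n -> 'rV[R]_m) (w : 'rV[R]_m -> 'rV[R]_m -> R).
Hypotheses (oA : open A) (sf : smooth_on A f).

Let e (l : 'I_m) : 'rV[R]_m := delta_mx 0 l.

(** Chain rule for the pulled-back form: one term differentiates the coefficients of [w] in the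
    direction of the image of [X], the other contains second derivatives of [f] and is symmetric in
    [X] and [Y]. *)
Let derive_pullback y X Y : open B -> A y -> (forall z, A z -> B (f z)) ->
  (forall v, smooth_on B (w^~ v)) -> (forall z, B z -> islin (w z)) ->
  'D_X (fun z => w (f z) ('D_Y f z)) y =
    'D_('D_X f y) (w^~ ('D_Y f y)) (f y) +
    \sum_l w (f y) (e l) * 'D_X ('D_Y (fun z => f z 0 l)) y.
Proof.
move=> oB Ay AB sw lw.
have dwB l : differentiable (w^~ (e l)) (f y).
  by apply: smooth_diff (sw _) _; exact: AB.
have dfy := smooth_diff sf Ay.
have dwf l : differentiable (fun z => w (f z) (e l)) y.
  exact: (@differentiable_comp _ _ _ _ f (w^~ (e l))).
have dfc l : differentiable ('D_Y (fun z => f z 0 l)) y.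
  by apply: (smooth_diff _ Ay); apply/smooth_derive/smooth_coord.
have -> : 'D_X (fun z => w (f z) ('D_Y f z)) y =
    'D_X (\sum_l ((fun z => w (f z) (e l)) * 'D_Y (fun z => f z 0 l))) y.
  apply: near_eq_derive; apply: filterS (open_nbhs_nbhs (conj oA Ay)) => z Az.
  rewrite fct_sumE islin_basis; last exact/lw/AB.
  apply: eq_bigr => l _; rewrite derive_mx ?mxE//.
  exact: smooth_derivable sf Az.
rewrite derive_sum => [|l]; last by apply: derivableM; exact: diff_derivable.
rewrite (eq_bigr (fun l => w (f y) (e l) * 'D_X ('D_Y (fun z => f z 0 l)) y +
    ('D_Y f y) 0 l * 'D_('D_X f y) (w^~ (e l)) (f y))).
  rewrite big_split /= addrC; congr (_ + _).
  have -> : 'D_('D_X f y) (w^~ ('D_Y f y)) (f y) =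
     'D_('D_X f y) (\sum_l ('D_Y f y) 0 l *: (w^~ (e l))) (f y).
    apply: near_eq_derive; apply: filterS (open_nbhs_nbhs (conj oB (AB _ Ay))) => z Bz.
    rewrite fct_sumE islin_basis; last exact: lw.
    by apply: eq_bigr => l _; rewrite mulrC.
  have dw l : derivable (w^~ (e l)) (f y) ('D_X f y).
    exact: diff_derivable.
  rewrite derive_sum => [|l]; last exact/derivableZ.
  by apply: eq_bigr => l _; rewrite deriveZ.
move=> l _; rewrite deriveM; [|exact: diff_derivable|exact: diff_derivable].
congr (_ + _); rewrite derive_mx ?mxE; last exact: diff_derivable.
congr (_ * _).
by rewrite deriveE // (@diff_comp _ _ _ _ f (w^~ (e l))) //= !deriveE.
Qed.

(** Naturality of d under pull-back: antisymmetrization removes the second derivatives of [f], by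
    [derive_comm]. *)
Lemma dcf_pullback y X Y : open B -> A y -> (forall z, A z -> B (f z)) ->
  (forall v, smooth_on B (w^~ v)) -> (forall z, B z -> islin (w z)) ->
  dcf (fun z v => w (f z) ('D_v f z)) y X Y = dcf w (f y) ('D_X f y) ('D_Y f y).
Proof.
move=> oB Ay AB sw lw.
have E1 := derive_pullback X Y oB Ay AB sw lw.
have E2 := derive_pullback Y X oB Ay AB sw lw.
have S : \sum_l w (f y) (e l) * 'D_Y ('D_X (fun z => f z 0 l)) y =
    \sum_l w (f y) (e l) * 'D_X ('D_Y (fun z => f z 0 l)) y.
  apply: eq_bigr => l _; apply: congr1.
  exact: (derive_comm X Y oA Ay (smooth_coord 0 l oA sf)).
have K (a b c : R) : (a + c) - (b + c) = a - b by ring.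
exact: etrans (congr2 (fun a b => a - b) E1 (etrans E2 (congr1 (+%R _) S))) (K _ _ _).
Qed.

Lemma differentiable_pullback y v : A y -> open B -> (forall z, A z -> B (f z)) ->
  (forall v, smooth_on B (w^~ v)) -> (forall z, B z -> islin (w z)) ->
  differentiable (fun z => w (f z) ('D_v f z)) y.
Proof.
move=> Ay oB AB sw lw.
have E : {near y, (\sum_l ((fun z => w (f z) (e l)) * (fun z => ('D_v f z) 0 l))) =1
    (fun z => w (f z) ('D_v f z))}.
  apply: filterS (open_nbhs_nbhs (conj oA Ay)) => z Az.
  by rewrite fct_sumE [RHS]islin_basis //; exact/lw/AB.
apply: near_differentiable E _; apply: differentiable_sum => l.
apply: differentiableM.
  apply: (@differentiable_comp _ _ _ _ f (w^~ (e l))); first exact: smooth_diff sf Ay.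
  by apply: smooth_diff (sw _) _; exact: AB.
by apply: (smooth_diff _ Ay); apply: smooth_coord => //; exact: smooth_derive.
Qed.

(** Here [u] is a field of covectors along [f], as for the coframes of a lifting, and need not come
    from a form on the target. *)
Lemma smooth_pullback (u : 'rV[R]_n -> 'rV[R]_m -> R) v :
  (forall v, smooth_on A (u^~ v)) -> (forall z, A z -> islin (u z)) ->
  smooth_on A (fun z => u z ('D_v f z)).
Proof.
move=> su lu; apply: (@smooth_ext _ _ _ _ (fun z => \sum_l u z (e l) * ('D_v f z) 0 l)) => //.
  by move=> z Az; rewrite -islin_basis //; exact: lu.
apply: smooth_sum => // l; apply: smoothM => //.
by apply: smooth_coord => //; exact: smooth_derive.
Qed.

End OneForms.

(** * The wedge product *)

Section Wedge.
Variables (R : realType) (n : nat).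

(** Composition with a transposition shows that the sum does not depend on the position [x0]; summed
    over all positions, each permutation contributes the full sum of [h]. *)
Lemma sum_perm_at (k : nat) (h : 'I_k.+1 -> R) (x0 : 'I_k.+1) :
  \sum_(s : 'S_k.+1) h (s x0) = k`!%:R * \sum_x h x.
Proof.
have indep x : \sum_(s : 'S_k.+1) h (s x) = \sum_(s : 'S_k.+1) h (s x0).
  rewrite (reindex_inj (mulgI (tperm x0 x))) /=; apply: eq_bigr => s _.
  by rewrite permM tpermR.
have /eqP : k.+1%:R * \sum_(s : 'S_k.+1) h (s x0) = k.+1%:R * (k`!%:R * \sum_x h x).
  rewrite mulr_natl -[X in _ *+ X](card_ord k.+1) -sumr_const.
  rewrite (eq_bigr (fun x => \sum_(s : 'S_k.+1) h (s x))) => [|x _]; last by rewrite indep.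
  rewrite exchange_big /= (eq_bigr (fun=> \sum_x h x)) => [|s _].
    by rewrite sumr_const card_Sn factS mulrA -natrM mulr_natl.
  by rewrite [RHS](reindex_inj (@perm_inj _ s)).
by rewrite (inj_eq (mulfI _)) ?pnatr_eq0 // => /eqP.
Qed.

(** Expansion along the last column. The term of a permutation [s] depends only on the image of the
    last index, and the k! permutations sharing that image cancel the normalization of [wedge]. *)
Lemma wedge_det k (g : nat -> 'rV[R]_n -> R) (v : 'M[R]_(k + 1, n)) :
  wedge (fun u : 'M[R]_(k, n) => \det (\matrix_(i, j < k) g j (row i u))) (g k) v =
  \det (\matrix_(i, j < k + 1) g j (row i v)).
Proof.
set M := \matrix_(i, j < k + 1) g j (row i v).
pose last : 'I_(k + 1) := rshift k ord0.
(* The last column of [M] is replaced by the unit vector at row [x], so that the determinant is a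
   cofactor; permuting the rows by [s] brings the 1 to the corner and makes the matrix block
   triangular. *)
pose N (x : 'I_(k + 1)) : 'M[R]_(k + 1) :=
  \matrix_(i, j) if j == last then (i == x)%:R else M i j.
have N_cof x : \det (N x) = cofactor M x last.
  rewrite (expand_det_col _ last) (bigD1 x) //= big1 => [|y /negbTE yx]; last first.
    by rewrite !mxE !eqxx yx mul0r.
  rewrite !mxE !eqxx mul1r addr0 /cofactor; congr (_ * \det _).
  apply/matrixP => i j; rewrite !mxE.
  by rewrite eq_sym (negbTE (neq_lift _ _)).
have N_perm (s : 'S_(k + 1)) :
    (-1) ^+ s * \det (\matrix_(i, j < k) g j (row i (usubmx (row_perm s v)))) =
    \det (N (s last)).
  have -> : N (s last) = row_perm s^-1 (row_perm s (N (s last))).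
    by rewrite -row_permM mulVg row_perm1.
  rewrite [in RHS]row_permE det_mulmx det_perm odd_permV; congr (_ * _).
  rewrite -[X in _ = \det X]submxK.
  have -> : ursubmx (row_perm s (N (s last))) = 0.
    apply/matrixP => i j; rewrite !mxE [j]ord1 eqxx (inj_eq (@perm_inj _ s)).
    by rewrite eq_lrshift.
  have -> : drsubmx (row_perm s (N (s last))) = 1.
    by apply/matrixP => i j; rewrite !mxE [j]ord1 [i]ord1 !eqxx.
  rewrite det_lblock det1 mulr1; congr (\det _).
  apply/matrixP => i j; rewrite !mxE eq_lrshift; congr g.
  by apply/rowP => l; rewrite !mxE.
rewrite (expand_det_col M last) /wedge factS fact0 muln1 muln1.
apply: (canLR (mulKf _)); first by rewrite pnatr_eq0 -lt0n fact_gt0.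
rewrite (eq_bigr (fun s : 'S_(k + 1) => (fun x => M x last * cofactor M x last) (s last))).
  (* The size is generalized to an equation because [k + 1] and [k.+1] are not convertible for a
     variable [k]. *)
  have sum_at : forall (l : nat) (e : l = k.+1) (h : 'I_l -> R) x0,
      \sum_(s : 'S_l) h (s x0) = k`!%:R * \sum_x h x.
    by move=> l e; subst l; exact: sum_perm_at.
  by rewrite (sum_at _ (addn1 k) (fun x => M x last * cofactor M x last)).
move=> s _; rewrite mulrA N_perm N_cof mulrC; congr (_ * _).
rewrite mxE /= addn0.
by congr g; apply/rowP => l; rewrite !mxE.
Qed.

Lemma wedge11 (a b : 'M[R]_(1, n) -> R) (v : 'M[R]_(2, n)) :
  wedge a b v = a (row 0 v) * b (row 1 v) - a (row 1 v) * b (row 0 v).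
Proof.
pose g (j : nat) := if j == 0%N then a else b.
have -> : wedge a b v =
    wedge (fun u : 'M[R]_(1, n) => \det (\matrix_(i, j < 1) g j (row i u))) (g 1%N) v.
  congr (_ * _); apply: eq_bigr => s _; rewrite det_mx11 mxE /g /=.
  by congr (_ * (a _ * _)); apply/rowP => l; rewrite [RHS]mxE.
rewrite wedge_det (expand_det_row _ 0) !big_ord_recl big_ord0 /cofactor !det_mx11 !mxE /=.
rewrite /g /= expr0 expr1 mul1r mulN1r addr0 mulrN.
congr (a _ * b _ - _); last rewrite mulrC; last congr (a _ * b _);
  by congr (row _ _); apply: val_inj.
Qed.

Lemma alternating_islin (w : 'M[R]_(1, n) -> R) : alternating w <-> islin w.
Proof.
split=> [[lw _] b c x y|lw].
  apply: (lw _ _ _ 0); first by apply/rowP => l; rewrite !mxE.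
    by apply/matrixP => -[].
  by apply/matrixP => -[].
split=> [A B C i b c|A i j]; last by rewrite [i]ord1 [j]ord1 eqxx.
have row1 (D : 'M[R]_(1, n)) : row i D = D.
  by apply/matrixP => k l; rewrite mxE [k]ord1 [i]ord1.
by rewrite !row1 => -> _ _.
Qed.

(** In each term the distinguished row is an argument of exactly one of the two factors, whence
    linearity. If two rows agree, composing [s] with their transposition changes the sign of the
    term only, so the sum is its own opposite. *)
Lemma wedge_alternating k l (a : 'M[R]_(k, n) -> R) (b : 'M[R]_(l, n) -> R) :
  alternating a -> alternating b -> alternating (wedge a b).
Proof.
move=> [la _] [lb _]; split=> [A B C i x y Ai BA CA|A i j ij Aij].
  rewrite /wedge mulrCA [y * _]mulrCA -mulrDr; congr (_ * _).
  rewrite !mulr_sumr -big_split /=; apply: eq_bigr => s _.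
  have rA r : row r (row_perm s A) = row (s r) A by apply/rowP => c; rewrite !mxE.
  have rB r : row r (row_perm s B) = row (s r) B by apply/rowP => c; rewrite !mxE.
  have rC r : row r (row_perm s C) = row (s r) C by apply/rowP => c; rewrite !mxE.
  have offB r : r != i -> row r B = row r A.
    rewrite eq_sym => ri; have [r' -> _] := unlift_some ri.
    by apply/rowP => c; have /rowP/(_ c) := congr1 (row r') BA; rewrite !mxE.
  have offC r : r != i -> row r C = row r A.
    rewrite eq_sym => ri; have [r' -> _] := unlift_some ri.
    by apply/rowP => c; have /rowP/(_ c) := congr1 (row r') CA; rewrite !mxE.
  have ru (D : 'M[R]_(k + l, n)) r : row r (usubmx D) = row (lshift l r) D.
    by apply/rowP => c; rewrite !mxE.
  have rd (D : 'M[R]_(k + l, n)) r : row r (dsubmx D) = row (rshift k r) D.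
    by apply/rowP => c; rewrite !mxE.
  have rr p (D : 'M[R]_(p, n)) r r' : row r (row' r' D) = row (fintype.lift r' r) D.
    by apply/rowP => c; rewrite !mxE.
  have [[j sj]|[j sj]] : (exists j, s (lshift l j) = i) \/ (exists j, s (rshift k j) = i).
    case: (splitP ((s^-1)%g i)) => j ej; [left|right]; exists j;
      by rewrite -[RHS](permKV s); congr (s _); apply: val_inj; rewrite /= ej.
  - have eB : dsubmx (row_perm s B) = dsubmx (row_perm s A).
      apply/row_matrixP => r; rewrite !rd rA rB offB // -sj (inj_eq perm_inj).
      by rewrite eq_rlshift.
    have eC : dsubmx (row_perm s C) = dsubmx (row_perm s A).
      apply/row_matrixP => r; rewrite !rd rA rC offC // -sj (inj_eq perm_inj).
      by rewrite eq_rlshift.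
    rewrite eB eC (la _ (usubmx (row_perm s B)) (usubmx (row_perm s C)) j x y).
    + move: (a _) (a _) (b _) ((-1) ^+ s) => p q r t; ring.
    + by rewrite !ru rA rB rC sj.
    + by apply/row_matrixP => r; rewrite !rr !ru rA rB offB // -sj (inj_eq perm_inj)
        (inj_eq (@lshift_inj _ _)) eq_sym neq_lift.
    + by apply/row_matrixP => r; rewrite !rr !ru rA rC offC // -sj (inj_eq perm_inj)
        (inj_eq (@lshift_inj _ _)) eq_sym neq_lift.
  - have eB : usubmx (row_perm s B) = usubmx (row_perm s A).
      apply/row_matrixP => r; rewrite !ru rA rB offB // -sj (inj_eq perm_inj).
      by rewrite eq_lrshift.
    have eC : usubmx (row_perm s C) = usubmx (row_perm s A).
      apply/row_matrixP => r; rewrite !ru rA rC offC // -sj (inj_eq perm_inj).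
      by rewrite eq_lrshift.
    rewrite eB eC (lb _ (dsubmx (row_perm s B)) (dsubmx (row_perm s C)) j x y).
    + move: (b _) (b _) (a _) ((-1) ^+ s) => p q r t; ring.
    + by rewrite !rd rA rB rC sj.
    + by apply/row_matrixP => r; rewrite !rr !rd rA rB offB // -sj (inj_eq perm_inj)
        (inj_eq (@rshift_inj _ _)) eq_sym neq_lift.
    + by apply/row_matrixP => r; rewrite !rr !rd rA rC offC // -sj (inj_eq perm_inj)
        (inj_eq (@rshift_inj _ _)) eq_sym neq_lift.
rewrite /wedge; set S := \sum_(s : _) _; suff -> : S = 0 by rewrite mulr0.
suff /eqP : S = - S by rewrite -addr_eq0 -mulr2n mulrn_eq0 => /eqP.
rewrite {1}/S (reindex_inj (mulIg (tperm i j))) /= -sumrN; apply: eq_bigr => s _.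
have -> : row_perm (s * tperm i j)%g A = row_perm s A.
  apply/row_matrixP => r; apply/rowP => c; rewrite !mxE permM.
  by case: tpermP => [->|->|//]; move/rowP/(_ c): Aij; rewrite !mxE.
by rewrite odd_permM odd_tperm ij addbT signrN mulNr.
Qed.

End Wedge.

(** * Coframes and congruences *)

Section Coframes.
Variables (R : realType).

Definition coef n m (e : 'I_m -> 'rV[R]_n -> R) : 'M[R]_(n, m) :=
  \matrix_(i, j) e j (delta_mx 0 i).

Lemma mul_coef n m (e : 'I_m -> 'rV[R]_n -> R) v j :
  islin (e j) -> (v *m coef e) 0 j = e j v.
Proof.
move=> le; rewrite mxE (islin_basis v le); apply: eq_bigr => l _.
by rewrite mxE mulrC.
Qed.

Lemma coef_unit n (e : 'I_n -> 'rV[R]_n -> R) :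
  (forall j, islin (e j)) -> (forall v, (forall j, e j v = 0) -> v = 0) ->
  coef e \in unitmx.
Proof.
move=> le e0; rewrite -row_free_unit -kermx_eq0; apply/eqP/row_matrixP => i.
rewrite row0; apply: e0 => j; rewrite -mul_coef //.
have /sub_kermxP -> : (row i (kermx (coef e)) <= kermx (coef e))%MS by exact: row_sub.
by rewrite mxE.
Qed.

Lemma coef_mul n m (e : 'I_m -> 'rV[R]_n -> R) p (A : 'M[R]_(p, n)) i j :
  islin (e j) -> (A *m coef e) i j = e j (row i A).
Proof. by move=> le; rewrite -mul_coef // -row_mul [RHS]mxE. Qed.

Lemma dualP n (e : 'I_n -> 'rV[R]_n -> R) k j :
  coef e \in unitmx -> (forall j, islin (e j)) ->
  e j (row k (invmx (coef e))) = (k == j)%:R.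
Proof. by move=> ue le; rewrite -coef_mul // mulVmx // mxE. Qed.

Lemma dual_expand n (e : 'I_n -> 'rV[R]_n -> R) v :
  coef e \in unitmx -> (forall j, islin (e j)) ->
  v = \sum_k e k v *: row k (invmx (coef e)).
Proof.
move=> ue le; rewrite -[LHS](mulmxK ue) mulmx_sum_row.
by apply: eq_bigr => k _; rewrite mul_coef.
Qed.

Lemma coef_continuous (T : topologicalType) n m (e : T -> 'I_m -> 'rV[R]_n -> R) x :
  (forall j v, {for x, continuous (fun z => e z j v)}) ->
  forall r s, {for x, continuous (fun z => coef (e z) r s)}.
Proof.
move=> ce r s.
have -> : (fun z => coef (e z) r s) = (fun z => e z s (delta_mx 0 r)).
  by apply/funext => z; rewrite mxE.
exact: ce.
Qed.

Lemma gauge_mx_continuous (T : topologicalType) n (e e' : T -> 'I_n -> 'rV[R]_n -> R)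
    x k j : coef (e x) \in unitmx ->
  (forall j v, {for x, continuous (fun z => e z j v)}) ->
  (forall j v, {for x, continuous (fun z => e' z j v)}) ->
  {for x, continuous (fun z => (invmx (coef (e z)) *m coef (e' z)) k j)}.
Proof.
move=> ux ce ce'; apply: mulmx_continuous; last exact: coef_continuous.
by apply: invmx_continuous => //; exact: coef_continuous.
Qed.

Definition pr n (X Y : 'rV[R]_n) : 'M[R]_(2, n) := col_mx X Y.

Lemma row_pr0 n (X Y : 'rV[R]_n) : row 0 (pr X Y) = X.
Proof.
have -> : (0 : 'I_2) = @lshift 1 1 0 by exact: val_inj.
by rewrite (@rowKu _ 1 1) row_id.
Qed.

Lemma row_pr1 n (X Y : 'rV[R]_n) : row 1 (pr X Y) = Y.
Proof.
have -> : (1 : 'I_2) = @rshift 1 1 0 by exact: val_inj.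
by rewrite (@rowKd _ 1 1) row_id.
Qed.

(** Each correction term contains a generator evaluated at [X] or at [Y]. All congruences of the
    structure equations are used through this evaluation. *)
Lemma congruent_ker n (s : seq ('rV[R]_n -> R)) (w1 w2 : 'M[R]_(2, n) -> R) X Y :
  @congruent R n s 1 w1 w2 -> (forall j, (j < size s)%N -> nth (fun=> 0) s j X = 0) ->
  (forall j, (j < size s)%N -> nth (fun=> 0) s j Y = 0) ->
  w1 (pr X Y) = w2 (pr X Y).
Proof.
move=> [eta [_ E]] sX sY; apply/eqP; rewrite -subr_eq0 E big1 // => j _.
by rewrite (wedge11 _ _ (pr X Y)) row_pr0 row_pr1 sX // sY // !mul0r subrr.
Qed.

(** A converse of [congruent_ker] for two independent covectors: a 2-covector that vanishes on their
    common kernel lies in the ideal that they generate. *)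
Lemma congruent_intro n (a b : 'rV[R]_n -> R) (ea eb : 'rV[R]_n)
    (D : 'rV[R]_n -> 'rV[R]_n -> R) (w1 w2 : 'M[R]_(2, n) -> R) :
  islin a -> islin b -> a ea = 1 -> a eb = 0 -> b ea = 0 -> b eb = 1 ->
  (forall X, islin (D X)) -> (forall X Y, D X Y = - D Y X) ->
  (forall v, w1 v - w2 v = D (row 0 v) (row 1 v)) ->
  (forall X Y, a X = 0 -> b X = 0 -> a Y = 0 -> b Y = 0 -> D X Y = 0) ->
  @congruent R n [:: a; b] 1 w1 w2.
Proof.
move=> la lb aa ab ba bb lD aD wD D0.
(* Contraction with [ea] gives the factor of [a]. In the factor of [b] the multiple of [a] is
   subtracted so that the value on [ea, eb] is not counted twice. *)
exists (fun j v => if j == ord0 then D ea v else D eb v - D eb ea * a v); split=> [j|v].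
  apply/alternating_islin => x y X Y /=; case: ifP => _; first exact: lD.
  by rewrite (lD eb x y X Y) (la x y X Y); ring.
rewrite wD !big_ord_recl big_ord0 /= addr0.
rewrite (wedge11 _ (fun v : 'rV_n => D ea v)).
rewrite (wedge11 _ (fun v : 'rV_n => D eb v - D eb ea * a v)).
move: (row 0 v) (row 1 v) => X Y {v wD}.
have lD' Z x y X' Y' : D (x *: X' + y *: Y') Z = x * D X' Z + y * D Y' Z.
  by rewrite aD lD (aD X') (aD Y'); ring.
have DXX Z : D Z Z = 0 by have := aD Z Z; lra.
(* [X'] and [Y'] are the projections of [X] and [Y] to the common kernel along [ea] and [eb]. *)
pose X' := 1 *: X + 1 *: (- a X *: ea + - b X *: eb).
pose Y' := 1 *: Y + 1 *: (- a Y *: ea + - b Y *: eb).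
have H : D X' Y' = 0.
  by apply: D0; rewrite !(la, lb) ?aa ?ab ?ba ?bb; ring.
move: H; rewrite !lD !lD' !DXX (aD X ea) (aD X eb) (aD ea eb) => H.
by lra.
Qed.

End Coframes.

(** * Forms on manifolds and integral elements *)

Section Charts.
Variables (R : realType) (n : nat) (M : manifold R n).
Implicit Types (U : set M) (i j : chart M).

Definition img i U : set 'rV[R]_n := mcrd i @` (mdom i `&` U).

Lemma imgP i U x : img i U x <->
  (mcrd i @` mdom i) x /\ U (minv i x) /\ mdom i (minv i x) /\ mcrd i (minv i x) = x.
Proof.
split=> [[p [dp Up] <-]|[_ [Ux [dx xE]]]]; last by exists (minv i x).
by rewrite !mcrdK //; split=> //; exists p.
Qed.

Lemma mem_img i U p : mdom i p -> U p -> img i U (mcrd i p).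
Proof. by move=> dp Up; exists p. Qed.

Lemma img_open i U : open U -> open (img i U).
Proof.
move=> oU.
have -> : img i U = (mcrd i @` mdom i) `&` minv i @^-1` U.
  apply/seteqP; split=> x; first by move=> /imgP[? []].
  by move=> [[p dp <-]]; rewrite /= mcrdK // => Up; exact: mem_img.
have oM := @mimg_open _ _ M i.
have := @minv_continuous _ _ M i; rewrite (continuous_open_subspace _ oM) => cM.
rewrite openE => x [Mx Ux]; have := cM x (mem_set Mx).
move=> cx; apply: filterI; first exact: open_nbhs_nbhs.
by apply: cx; exact: open_nbhs_nbhs.
Qed.

Lemma extd1 (w : form M 1) p i v :
  extd w p i v =
  dcf (fun x u => w (minv i x) i u) (mcrd i p) (row 0 v) (row 1 v).
Proof.
rewrite /extd !big_ord_recl big_ord0 addr0 expr0 expr1 mul1r mulN1r /dcf.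
have e1 : fintype.lift ord0 (ord0 : 'I_1) = 1 :> 'I_2 by exact: val_inj.
have -> : row' ord0 v = row 1 v by apply/matrixP => a b; rewrite !mxE [a]ord1 e1.
have -> : row' (fintype.lift ord0 ord0) v = row 0 v.
  by apply/matrixP => a b; rewrite !mxE [a]ord1; congr (v _ _); exact: val_inj.
by rewrite e1.
Qed.

Lemma form_islin U (w : form M 1) p i :
  is_form U w -> U p -> mdom i p -> islin (w p i).
Proof. by move=> [cw _] Up ip; apply/alternating_islin; have [] := cw p Up i ip. Qed.

Lemma form_smooth U (w : form M 1) i v :
  is_form U w -> smooth_on (img i U) (fun x => w (minv i x) i v).
Proof. by move=> [_ sw]; exact: sw. Qed.

Lemma trans_jacobian i j p v : mdom i p -> mdom j p ->
  v *m jacobian (mcrd j \o minv i) (mcrd i p) = 'D_v (mcrd j \o minv i) (mcrd i p).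
Proof.
move=> ip jp; rewrite deriveEjacobian //.
by apply: (smooth_diff (@mtrans_smooth _ _ M i j)); exact: mem_img.
Qed.

(** Since [extd] is computed separately in each chart, its covariance is the naturality of d for the
    transition map. *)
Lemma extd_trans U (w : form M 1) p i j v : open U -> is_form U w -> U p ->
  mdom i p -> mdom j p ->
  extd w p i v = extd w p j (v *m jacobian (mcrd j \o minv i) (mcrd i p)).
Proof.
move=> oU fw Up ip jp; have [cw sw] := fw.
pose A := img i (mdom j `&` U); pose B := img j U.
have oA : open A by apply: img_open; apply: openI => //; exact: mdom_open.
have oB : open B by exact: img_open.
have Ap : A (mcrd i p) by exact: mem_img.
have sf : smooth_on A (mcrd j \o minv i).
  apply: smooth_sub (@mtrans_smooth _ _ M i j) => x [q [iq [jq _]] <-].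
  exact: mem_img.
have AB x : A x -> B ((mcrd j \o minv i) x).
  by move=> /imgP[_ [[jx Ux] [ix _]]]; exact: mem_img.
rewrite !extd1 !row_mul !trans_jacobian //.
rewrite -[mcrd j p](congr1 (mcrd j) (mcrdK ip)).
rewrite -(@dcf_pullback R n n A B (mcrd j \o minv i) (fun x u => w (minv j x) j u)) //.
- apply: dcf_near; apply: filterS (open_nbhs_nbhs (conj oA Ap)) => x.
  move=> /imgP[_ [[jx Ux] [ix xE]]]; apply/funext => u.
  have [_ /(_ j jx u)] := cw _ Ux i ix; rewrite xE => ->.
  rewrite -[in X in jacobian _ X]xE trans_jacobian // xE /=.
  by rewrite mcrdK.
- by move=> u; exact: sw.
- by move=> x /imgP[_ [Ux [jx _]]]; exact: form_islin fw Ux jx.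
Qed.

Lemma form_wedge U k l (a : form M k) (b : form M l) : open U ->
  is_form U a -> is_form U b -> is_form U (formW a b).
Proof.
move=> oU [ca sa] [cb sb]; split=> [p Up i ip|i v].
  have [aa ta] := ca p Up i ip; have [ab tb] := cb p Up i ip.
  split=> [|j jp v]; first exact: wedge_alternating.
  rewrite /formW /wedge; congr (_ * _); apply: eq_bigr => s _; congr (_ * _).
  rewrite (ta j jp) (tb j jp); set J := jacobian _ _.
  have -> : row_perm s (v *m J) = row_perm s v *m J by rewrite !row_permE mulmxA.
  by rewrite -(mul_usub_mx (row_perm s v)) -(mul_dsub_mx (row_perm s v)).
have oA : open (img i U) by exact: img_open.
apply: smoothM => //; first exact: smooth_cst.
apply: smooth_sum => // s; apply: smoothM => //; first exact: smooth_cst.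
by apply: smoothM.
Qed.

Lemma form_add U k (a b : form M k) : open U ->
  is_form U a -> is_form U b -> is_form U (formD a b).
Proof.
move=> oU [ca sa] [cb sb]; split=> [p Up i ip|i v]; last first.
  by apply: smoothD; [exact: img_open|exact: sa|exact: sb].
have [[la0 la1] ta] := ca p Up i ip; have [[lb0 lb1] tb] := cb p Up i ip.
split=> [|j jp v]; last by rewrite /formD (ta j jp) (tb j jp).
split=> [A B C r x y eA eB eC|A r r' rr' eA]; rewrite /formD.
  by rewrite (la0 _ _ _ _ _ _ eA eB eC) (lb0 _ _ _ _ _ _ eA eB eC); ring.
by rewrite (la1 A r r' rr' eA) (lb1 A r r' rr' eA) addr0.
Qed.

Lemma form_zero U k : is_form U (@form0 R n M k).
Proof.
split=> [p Up i ip|i v]; last exact: smooth_cst.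
split=> [|j jp v]; last by [].
by split=> [A B C r x y|] //; rewrite /form0 !mulr0 addr0.
Qed.

(** A test ideal for the minimality clause of [generated]: the forms that vanish, at the single
    point [p], on all tuples from the row space of [B]. *)
Lemma ideal_vanishing U r p i (B : 'M[R]_(r, n)) : open U -> U p -> mdom i p ->
  is_ideal U (fun k (w : form M k) =>
    is_form U w /\ forall c : 'M[R]_(k, r), w p i (c *m B) = 0).
Proof.
move=> oU Up ip; split.
- by move=> k w [].
- by move=> k w w' [_ w0] fw' ww'; split=> // c; rewrite -(ww' p i Up ip).
- by move=> k; split=> //; exact: form_zero.
- move=> k w w' [fw w0] [fw' w0']; split=> [|c]; first exact: form_add.
  by rewrite /formD w0 w0' addr0.
- move=> k l w eta [fw w0] fe; split; (split=> [|c]; first exact: form_wedge).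
    rewrite /formW /wedge big1 ?mulr0 // => s _.
    rewrite row_permE mulmxA -row_permE -(mul_usub_mx (row_perm s c)) w0.
    by rewrite mul0r mulr0.
  rewrite /formW /wedge big1 ?mulr0 // => s _.
  rewrite row_permE mulmxA -row_permE -(mul_dsub_mx (row_perm s c)) w0.
  by rewrite !mulr0.
Qed.

End Charts.

Section IntegralElements.
Variables (R : realType) (M : manifold R 5) (I : graded_set M).
Variables (U U' : set M) (w w' : 'I_5 -> form M 1) (p : M) (i : chart M).
Hypotheses (aw : adapted_coframing I U w) (aw' : adapted_coframing I U' w').
Hypotheses (Up : U p) (U'p : U' p) (ip : mdom i p).
Variables X Y : 'rV[R]_5.
Hypotheses (X0 : w 0 p i X = 0) (Y0 : w 0 p i Y = 0).
Hypotheses (XY12 : wedge (w 1 p i) (w 2 p i) (pr X Y) = 0).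
Hypotheses (XY34 : wedge (w 3 p i) (w 4 p i) (pr X Y) = 0).

(** The forms on [U] vanishing at [p] on the span of [X] and [Y] form an ideal containing the
    generators built from [w], hence all of [I]; the generators built from [w'] are locally in [I].
    So being an integral element does not depend on the coframing. *)
Lemma integral_element :
  [/\ w' 0 p i X = 0, wedge (w' 1 p i) (w' 2 p i) (pr X Y) = 0
    & wedge (w' 3 p i) (w' 4 p i) (pr X Y) = 0].
Proof.
have [oU fw [_ _ _ _ gI] _ _] := aw.
have [oU' fw' [_ _ _ [l0 l1 l2] _] _ _] := aw'.
have lw j : islin (w j p i) by exact: form_islin (fw j) Up ip.
have rowE r (c : 'M[R]_(r, 2)) s :
    row s (c *m pr X Y) = c s 0 *: X + c s 1 *: Y.
  rewrite row_mul mulmx_sum_row !big_ord_recl big_ord0 addr0 !mxE.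
  rewrite row_pr0; congr (_ + _ *: _); first by congr (c _ _); exact: val_inj.
  by rewrite -[RHS](row_pr1 X); congr (row _ _); exact: val_inj.
pose J k (u : form M k) := is_form U u /\ forall c : 'M[R]_(k, 2), u p i (c *m pr X Y) = 0.
have iJ : is_ideal U J by exact: ideal_vanishing.
have J0 : J 1%N (w 0).
  split=> [|c]; first exact: fw.
  have -> : c *m pr X Y = c 0 0 *: X + c 0 1 *: Y by rewrite -rowE row_id.
  by rewrite lw X0 Y0 !mulr0 addr0.
have J2 a b : wedge (w a p i) (w b p i) (pr X Y) = 0 -> J 2%N (formW (w a) (w b)).
  rewrite wedge11 row_pr0 row_pr1 => E.
  split=> [|c]; first by apply: (@form_wedge _ _ _ U 1 1); [exact: oU|exact: fw|exact: fw].
  rewrite /formW (wedge11 _ _ (c *m pr X Y)) !rowE !lw.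
  have -> : (c 0 0 * w a p i X + c 0 1 * w a p i Y) * (c 1 0 * w b p i X + c 1 1 * w b p i Y) -
      (c 1 0 * w a p i X + c 1 1 * w a p i Y) * (c 0 0 * w b p i X + c 0 1 * w b p i Y) =
      (c 0 0 * c 1 1 - c 0 1 * c 1 0) * (w a p i X * w b p i Y - w a p i Y * w b p i X).
    by ring.
  by rewrite E mulr0.
have vanish k (psi : form M k) : locally_in I U' psi ->
    forall c : 'M[R]_(k, 2), psi p i (c *m pr X Y) = 0.
  move=> /(_ p U'p)[W [psi' [oW Wp Ipsi E]]] c.
  have [_ /(_ c) <-] := gI k psi' Ipsi J iJ J0 (J2 1 2 XY12) (J2 3 4 XY34).
  by symmetry; apply: E.
have := vanish _ _ l1 1%:M; have := vanish _ _ l2 1%:M; rewrite mul1mx => ? ?.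
(* The 1-form is tested on the 1 x 2 coefficient row that selects [X]. *)
split=> //; have := vanish _ _ l0 (\row_s (s == 0)%:R).
have -> // : \row_s (s == 0)%:R *m pr X Y = X :> 'rV_5.
rewrite -[LHS](row_id 0) rowE !mxE !eqxx scale1r.
have -> : (1 : 'I_2) == 0 = false by [].
by rewrite scale0r addr0.
Qed.

End IntegralElements.

(** * 1-adapted coframings *)

Section WeakStructure.
Variables (R : realType) (n m : nat).

(** The terms in which a coefficient is differentiated vanish, because every [e k] kills both
    vectors. The predicate [P] selects the covectors that occur near [x], which is where block
    structure enters. *)
Lemma dcf_sum_null (P : pred 'I_m) (b : 'rV[R]_n -> 'rV[R]_n -> R)
    (e : 'I_m -> 'rV[R]_n -> 'rV[R]_n -> R) (g : 'I_m -> 'rV[R]_n -> R) x X Y :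
  (forall k, P k -> {for x, continuous (g k)}) ->
  (forall k v, P k -> differentiable ((e k)^~ v) x) ->
  (\forall z \near x, forall v, b z v = \sum_(k | P k) g k z * e k z v) ->
  (forall k, P k -> e k x X = 0) -> (forall k, P k -> e k x Y = 0) ->
  dcf b x X Y = \sum_(k | P k) g k x * dcf (e k) x X Y.
Proof.
move=> cg de bE eX eY.
have half X' Y' : (forall k, P k -> e k x Y' = 0) ->
    'D_X' (b^~ Y') x = \sum_(k | P k) g k x * 'D_X' ((e k)^~ Y') x.
  move=> eY'; rewrite -derive_sum_null // => [|k Pk]; last first.
    by apply: diff_derivable; exact: de.
  by apply: near_eq_derive; apply: filterS bE => z ->.
rewrite /dcf (half X Y eY) (half Y X eX) -sumrB.
by apply: eq_bigr => k _; rewrite mulrBr.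
Qed.

End WeakStructure.

Section Adapted.
Variables (R : realType) (M : manifold R 5) (I : graded_set M).

(* The two characteristic systems of a coframing, in either order. *)
Definition paired (a b c d : 'I_5) : Prop :=
  (a, b, c, d) = (1, 2, 3, 4) \/ (a, b, c, d) = (3, 4, 1, 2).

Definition alt2 n (e e' : 'rV[R]_n -> R) X Y : R := e X * e' Y - e Y * e' X.

Lemma wedge_pr n (e e' : 'rV[R]_n -> R) X Y : wedge e e' (pr X Y) = alt2 e e' X Y.
Proof. by rewrite (wedge11 _ _ (pr X Y)) row_pr0 row_pr1. Qed.

Section OneCoframing.
Variables (U : set M) (w : 'I_5 -> form M 1) (p : M) (i : chart M).
Hypotheses (aw : adapted_coframing I U w) (Up : U p) (ip : mdom i p).

Lemma adapted_islin j : islin (w j p i).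
Proof. by have [_ fw _ _ _] := aw; exact: form_islin (fw j) Up ip. Qed.

Lemma adapted_unit : coef (fun j => w j p i) \in unitmx.
Proof.
have [_ fw _ _ /(_ p i Up ip) [e0 _ _ _]] := aw.
by apply: coef_unit => // j; exact: adapted_islin.
Qed.

Definition dframe k : 'rV[R]_5 := row k (invmx (coef (fun j => w j p i))).

Lemma dframeP k j : w j p i (dframe k) = (k == j)%:R.
Proof. exact: (@dualP _ _ (fun j => w j p i) k j adapted_unit adapted_islin). Qed.

Lemma dframe_expand v : v = \sum_k w k p i v *: dframe k.
Proof. exact: (@dual_expand _ _ (fun j => w j p i) v adapted_unit adapted_islin). Qed.

Lemma adapted_d0 X Y : w 0 p i X = 0 -> w 0 p i Y = 0 ->
  extd (w 0) p i (pr X Y) =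
  alt2 (w 1 p i) (w 2 p i) X Y + alt2 (w 3 p i) (w 4 p i) X Y.
Proof.
have [_ _ _ _ /(_ p i Up ip) [_ c0 _ _]] := aw.
move=> X0 Y0; rewrite (congruent_ker c0) /=; last 2 first.
- by case.
- by case.
by rewrite !wedge_pr.
Qed.

Lemma adapted_da a b c d X Y : paired a b c d ->
  w 0 p i X = 0 -> w a p i X = 0 -> w b p i X = 0 ->
  w 0 p i Y = 0 -> w a p i Y = 0 -> w b p i Y = 0 ->
  extd (w a) p i (pr X Y) = 0 /\ extd (w b) p i (pr X Y) = 0.
Proof.
have [_ _ _ _ /(_ p i Up ip) [_ _ [c1 c2] [c3 c4]]] := aw.
case=> -[-> -> _ _] X0 Xa Xb Y0 Ya Yb; split.
- by rewrite (congruent_ker c1) //; case=> [|[|[|]]].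
- by rewrite (congruent_ker c2) //; case=> [|[|[|]]].
- by rewrite (congruent_ker c3) //; case=> [|[|[|]]].
- by rewrite (congruent_ker c4) //; case=> [|[|[|]]].
Qed.

Lemma extd_islin j X : islin (fun Y => extd (w j) p i (pr X Y)).
Proof.
have [oU fw _ _ _] := aw => x y Y Z.
rewrite !extd1 !row_pr0 !row_pr1; apply: (dcf_islin (w := fun z u => w j (minv i z) i u)).
  move=> v; apply: (smooth_diff (form_smooth i v (fw j))); exact: mem_img.
have oA : open (img i U) by exact: img_open.
apply: filterS (open_nbhs_nbhs (conj oA (mem_img ip Up))) => z /imgP[_ [Uz [iz _]]].
exact: form_islin (fw j) Uz iz.
Qed.

Lemma extd_anti j X Y : extd (w j) p i (pr X Y) = - extd (w j) p i (pr Y X).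
Proof. by rewrite !extd1 !row_pr0 !row_pr1 dcf_anti. Qed.

End OneCoframing.
End Adapted.

Section TwoCoframings.
Variables (R : realType) (M : manifold R 5) (I : graded_set M).
Variables (U U' : set M) (w w' : 'I_5 -> form M 1).
Hypotheses (aw : adapted_coframing I U w) (aw' : adapted_coframing I U' w').

Let E p i k := dframe w p i k.

Definition gauge p i k j : R := w' j p i (E p i k).

Lemma gauge_expand p i j v : U p -> U' p -> mdom i p ->
  w' j p i v = \sum_k gauge p i k j * w k p i v.
Proof.
move=> Up U'p ip; rewrite {1}(dframe_expand aw Up ip v).
have lw' := adapted_islin aw' U'p ip j.
by rewrite islin_sum //; apply: eq_bigr => k _; rewrite islinZ // mulrC.
Qed.

(** For [k] other than 0, the pair formed by [E k] and the zero vector satisfies the equations of an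
    integral element, so [w' 0] kills [E k]. *)
Lemma gauge0 p i k : U p -> U' p -> mdom i p -> k != 0 -> gauge p i k 0 = 0.
Proof.
move=> Up U'p ip k0.
have l j := islin0 (adapted_islin aw Up ip j).
have wE := dframeP aw Up ip.
have [] // := integral_element (X := E p i k) (Y := 0) aw aw' Up U'p ip.
- by rewrite wE (negbTE k0).
- by rewrite wedge_pr /alt2 !l !mulr0 mul0r subrr.
- by rewrite wedge_pr /alt2 !l !mulr0 mul0r subrr.
Qed.

(** Determinant of the diagonal block of the pair [a, b]. Its non-vanishing says that the transition
    does not exchange the two characteristic systems. *)
Definition minor p i a b : R :=
  gauge p i a a * gauge p i b b - gauge p i b a * gauge p i a b.

(** Dual vectors taken from different pairs span an integral element of [w], hence of [w']. *)
Lemma gauge_cross p i a b c d x y : U p -> U' p -> mdom i p -> paired a b c d ->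
  x \in [:: a; b] -> y \in [:: c; d] ->
  gauge p i x a * gauge p i y b = gauge p i y a * gauge p i x b.
Proof.
move=> Up U'p ip abcd xab ycd; apply/eqP; rewrite -subr_eq0; apply/eqP.
have wE := dframeP aw Up ip.
have H : [/\ w' 0 p i (E p i x) = 0,
    wedge (w' 1 p i) (w' 2 p i) (pr (E p i x) (E p i y)) = 0
  & wedge (w' 3 p i) (w' 4 p i) (pr (E p i x) (E p i y)) = 0].
  apply: (integral_element aw aw' Up U'p ip); rewrite ?wedge_pr /alt2 !wE;
  by move: xab ycd; rewrite !inE; case: abcd => -[-> -> -> ->];
     move=> /orP[]/eqP Ex /orP[]/eqP Ey; rewrite ?Ex ?Ey ?(mul0r, mulr0, subrr).
by move: H => [_]; rewrite !wedge_pr; case: abcd => -[-> -> _ _].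
Qed.

(** By [gauge_cross], the plane vector of values of [w' a, w' b] on [E y] is parallel to the
    corresponding vectors of [E a] and of [E b]. These are independent when the minor is nonzero, so
    it is zero. *)
Lemma gauge_block p i a b c d y : U p -> U' p -> mdom i p -> paired a b c d ->
  minor p i a b != 0 -> y \in [:: c; d] ->
  gauge p i y a = 0 /\ gauge p i y b = 0.
Proof.
move=> Up U'p ip abcd m0 ycd.
have := gauge_cross Up U'p ip abcd (mem_head a [:: b]) ycd.
have : b \in [:: a; b] by rewrite !inE eqxx orbT.
move=> /(gauge_cross Up U'p ip abcd)/(_ ycd) eb ea.
split; apply: (mulfI m0); rewrite mulr0 /minor.
  transitivity (gauge p i b b * (gauge p i y a * gauge p i a a)
     - gauge p i b a * (gauge p i y a * gauge p i a b)); first by ring.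
  rewrite -ea mulrCA; transitivity (gauge p i a a * (gauge p i y a * gauge p i b b) -
     gauge p i a a * (gauge p i b a * gauge p i y b)); first by ring.
  by rewrite eb subrr.
transitivity (gauge p i b b * (gauge p i a a * gauge p i y b)
   - gauge p i a b * (gauge p i b a * gauge p i y b)); first by ring.
by rewrite ea eb; ring.
Qed.

Lemma gauge_continuous i x k j : img i (U `&` U') x ->
  {for x, continuous (fun z => gauge (minv i z) i k j)}.
Proof.
move=> Ax; have [oU fw _ _ _] := aw; have [oU' fw' _ _ _] := aw'.
have /imgP[_ [[Ux U'x] [ix xE]]] := Ax.
have cw l v : {for x, continuous (fun z => w l (minv i z) i v)}.
  apply: smooth_continuous (form_smooth i v (fw l)) _; rewrite -xE; exact: mem_img.
have cw' l v : {for x, continuous (fun z => w' l (minv i z) i v)}.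
  apply: smooth_continuous (form_smooth i v (fw' l)) _; rewrite -xE; exact: mem_img.
have H := @gauge_mx_continuous R _ 5 (fun z l => w l (minv i z) i)
  (fun z l => w' l (minv i z) i) x k j (adapted_unit aw Ux ix) cw cw'.
have E' : \forall z \near x, (invmx (coef (fun l => w l (minv i z) i)) *m
    coef (fun l => w' l (minv i z) i)) k j = gauge (minv i z) i k j.
  have oA : open (img i (U `&` U')) by apply: img_open; exact: openI.
  apply: filterS (open_nbhs_nbhs (conj oA Ax)) => z /imgP[_ [[Uz U'z] [iz _]]].
  exact: (@coef_mul R 5 5 (fun l => w' l (minv i z) i) 5 _ k j (adapted_islin aw' U'z iz j)).
rewrite /prop_for /continuous_at -(nbhs_singleton E').
by apply: cvg_trans H; exact: near_eq_cvg E'.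
Qed.

(* The contact form does not enter [w' a] and [w' b], because [d(w' a)] would
   otherwise involve [w c /\ w d]. *)
Lemma gauge_contact p i a b c d : U p -> U' p -> mdom i p -> paired a b c d ->
  minor p i a b != 0 -> gauge p i 0 a = 0 /\ gauge p i 0 b = 0.
Proof.
move=> Up U'p ip abcd m0.
have [oU fw _ _ _] := aw; have [oU' fw' _ _ _] := aw'.
pose x := mcrd i p.
have Ax : img i (U `&` U') x by exact: mem_img.
have xE : minv i x = p by rewrite /x mcrdK.
have oA : open (img i (U `&` U')) by apply: img_open; exact: openI.
have nearA := open_nbhs_nbhs (conj oA Ax).
have nearm : \forall z \near x, minor (minv i z) i a b != 0.
  have cm : {for x, continuous (fun z => minor (minv i z) i a b)}.
    have gc k j := @gauge_continuous i x k j Ax.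
    exact: (cvgB (cvgM (gc a a) (gc b b)) (cvgM (gc b a) (gc a b))).
  have mx : minor (minv i x) i a b != 0 by rewrite xE.
  exact: (@cvgr_neq0 _ _ _ (nbhs x) _ _ _ cm mx).
have wE := dframeP aw Up ip.
have [ca cb] := gauge_block Up U'p ip abcd m0 (mem_head c [:: d]).
have dcd : d \in [:: c; d] by rewrite !inE eqxx orbT.
have [da db] := gauge_block Up U'p ip abcd m0 dcd.
(* Near [p] the expansion of [w' e] omits [w c] and [w d]. Of the remaining differentials only
   d([w 0]) is nonzero on [E c, E d], where it equals 1. *)
have key e : e \in [:: a; b] -> extd (w' e) p i (pr (E p i c) (E p i d)) = gauge p i 0 e.
  move=> eab.
  rewrite extd1 row_pr0 row_pr1.
  rewrite (@dcf_sum_null _ _ _ [pred k | k \notin [:: c; d]] _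
    (fun k z v => w k (minv i z) i v) (fun k z => gauge (minv i z) i k e)).
  - rewrite (bigD1 0) /=; last by case: abcd => -[_ _ -> ->].
    have dw k : dcf (fun z v => w k (minv i z) i v) (mcrd i p) (E p i c) (E p i d) =
       extd (w k) p i (pr (E p i c) (E p i d)) by rewrite extd1 row_pr0 row_pr1.
    rewrite -/x xE dw (adapted_d0 aw Up ip); last 2 first.
    + by rewrite wE; case: abcd => -[_ _ -> _].
    + by rewrite wE; case: abcd => -[_ _ _ ->].
    rewrite big1 ?addr0 => [|k /andP[kcd k0]].
      rewrite /alt2 !wE; case: abcd => -[_ _ -> ->];
      by rewrite !eqxx /= !(mul0r, mulr0, mulr1, subr0, add0r, addr0).
    rewrite dw; have [Ea Eb] := adapted_da (X := E p i c) (Y := E p i d) aw Up ip abcd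
      ltac:(by rewrite wE; case: abcd => -[_ _ -> _])
      ltac:(by rewrite wE; case: abcd => -[-> _ -> _])
      ltac:(by rewrite wE; case: abcd => -[_ -> -> _])
      ltac:(by rewrite wE; case: abcd => -[_ _ _ ->])
      ltac:(by rewrite wE; case: abcd => -[-> _ _ ->])
      ltac:(by rewrite wE; case: abcd => -[_ -> _ ->]).
    suff : k \in [:: a; b] by rewrite !inE => /orP[]/eqP->; rewrite ?Ea ?Eb mulr0.
    by move: kcd k0; case: abcd => -[-> -> -> ->]; case: k => -[|[|[|[|[|]]]]].
  - by move=> k _; exact: gauge_continuous.
  - move=> k v _; apply: (smooth_diff (form_smooth i v (fw k))); exact: mem_img.
  - near=> z => v.
    have /imgP[_ [[Uz U'z] [iz _]]] : img i (U `&` U') z by near: z.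
    have mz : minor (minv i z) i a b != 0 by near: z.
    rewrite gauge_expand // (bigID [pred k | k \notin [:: c; d]]) /= addrC big1 ?add0r //.
    move=> k; rewrite negbK => kcd.
    have [ka kb] := gauge_block Uz U'z iz abcd mz kcd.
    by move: eab; rewrite !inE => /orP[]/eqP->; rewrite ?ka ?kb mul0r.
  - move=> k kcd; rewrite -/x xE wE; case: eqP => // ck.
    by move: kcd; rewrite inE -ck mem_head.
  - move=> k kcd; rewrite -/x xE wE; case: eqP => // ck.
    by move: kcd; rewrite inE -ck dcd.
have cd0 : c != 0 by case: abcd => -[_ _ -> _].
have dd0 : d != 0 by case: abcd => -[_ _ _ ->].
(* Adaptedness of [w'] makes the left side of [key] vanish, because [E c] and [E d] are killed by
   [w' 0], [w' a] and [w' b]. *)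
have [Ea Eb] := adapted_da (X := E p i c) (Y := E p i d) aw' U'p ip abcd
  (gauge0 Up U'p ip cd0) ca cb (gauge0 Up U'p ip dd0) da db.
split; first by rewrite -key ?mem_head.
by rewrite -key // !inE eqxx orbT.
Unshelve. all: by end_near. Qed.

Lemma gauge_expand0 p i v : U p -> U' p -> mdom i p ->
  w' 0 p i v = gauge p i 0 0 * w 0 p i v.
Proof.
move=> Up U'p ip; rewrite gauge_expand // (bigD1 0) //= big1 ?addr0 // => k k0.
by rewrite gauge0 // mul0r.
Qed.

Lemma gauge_expand_pair p i a b c d e v : U p -> U' p -> mdom i p -> paired a b c d ->
  minor p i a b != 0 -> e \in [:: a; b] ->
  w' e p i v = \sum_(k | k \in [:: a; b]) gauge p i k e * w k p i v.
Proof.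
move=> Up U'p ip abcd m0 eab.
rewrite gauge_expand // (bigID [pred k | k \in [:: a; b]]) /= addrC big1 ?add0r //.
move=> k kab; have [->|k0] := eqVneq k 0.
  have [ga gb] := gauge_contact Up U'p ip abcd m0.
  by move: eab; rewrite !inE => /orP[]/eqP->; rewrite ?ga ?gb mul0r.
have kcd : k \in [:: c; d].
  by move: kab k0; case: abcd => -[-> -> -> ->]; case: k => -[|[|[|[|[|]]]]].
have [ga gb] := gauge_block Up U'p ip abcd m0 kcd.
by move: eab; rewrite !inE => /orP[]/eqP->; rewrite ?ga ?gb mul0r.
Qed.

End TwoCoframings.

(** * The invariants *)

Section Invariants.
Variables (R : realType) (M : manifold R 5) (I : graded_set M).

Lemma pr_rows n (v : 'M[R]_(2, n)) : pr (row 0 v) (row 1 v) = v.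
Proof.
apply/row_matrixP => k; have [->|->] : k = 0 \/ k = 1.
- by case: k => -[|[|//]] ?; [left|right]; exact: val_inj.
- by rewrite row_pr0.
- by rewrite row_pr1.
Qed.

Lemma pr_mul n m (X Y : 'rV[R]_n) (J : 'M[R]_(n, m)) : pr X Y *m J = pr (X *m J) (Y *m J).
Proof. exact: (@mul_col_mx _ 1 1). Qed.

Lemma alt2_islin n (e e' : 'rV[R]_n -> R) X :
  islin e -> islin e' -> islin (alt2 e e' X).
Proof. by move=> le le' x y Y Z; rewrite /alt2 le le'; ring. Qed.

Section Coframing.
Variables (U : set M) (w : 'I_5 -> form M 1) (p : M).
Hypotheses (aw : adapted_coframing I U w) (Up : U p).

(** The common kernel of [e a] and [e b] is spanned by [E 0], [E c], [E d]. Adaptedness kills the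
    component on [E c, E d], and the two components left are the sums and differences recorded by
    the invariants. *)
Lemma adapted_dpair i a b c d j X Y : mdom i p -> paired a b c d -> j \in [:: a; b] ->
  let E := dframe w p i in let e k := w k p i in
  e a X = 0 -> e b X = 0 -> e a Y = 0 -> e b Y = 0 ->
  extd (w j) p i (pr X Y) =
  extd (w j) p i (pr (E 0) (E c)) * alt2 (e 0) (e c) X Y +
  extd (w j) p i (pr (E 0) (E d)) * alt2 (e 0) (e d) X Y.
Proof.
move=> ip abcd jab E e Xa Xb Ya Yb.
pose D X Y := extd (w j) p i (pr X Y).
have lD Z : islin (D Z) by exact: extd_islin aw Up ip j Z.
have aD Z T : D Z T = - D T Z by exact: extd_anti.
have lD' Z x y X' Y' : D (x *: X' + y *: Y') Z = x * D X' Z + y * D Y' Z.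
  by rewrite aD lD (aD X') (aD Y'); ring.
have DXX Z : D Z Z = 0 by have := aD Z Z; lra.
have wE := dframeP aw Up ip.
have expand Z : e a Z = 0 -> e b Z = 0 ->
    Z = e 0 Z *: E 0 + 1 *: (e c Z *: E c + e d Z *: E d).
  move=> Za Zb; rewrite {1}(dframe_expand aw Up ip Z) scale1r.
  rewrite (bigD1 0) //=; congr (_ + _).
  have dc : d != c by case: abcd => -[_ _ -> ->].
  have c0 : c != 0 by case: abcd => -[_ _ -> _].
  have d0 : d != 0 by case: abcd => -[_ _ _ ->].
  rewrite (bigD1 c) //= (bigD1 d) /=; last by rewrite d0 dc.
  rewrite big1 ?addr0 // => k /andP[/andP[k0 kc] kd].
  suff : k \in [:: a; b].
    by rewrite !inE => /orP[]/eqP->; rewrite -/(e _ _) ?Za ?Zb scale0r.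
  by move: k0 kc kd; case: abcd => -[-> -> -> ->]; case: k => -[|[|[|[|[|]]]]].
have Dcd : D (E c) (E d) = 0.
  have [Ea Eb] := adapted_da (X := E c) (Y := E d) aw Up ip abcd
      ltac:(by rewrite wE; case: abcd => -[_ _ -> _])
      ltac:(by rewrite wE; case: abcd => -[-> _ -> _])
      ltac:(by rewrite wE; case: abcd => -[_ -> -> _])
      ltac:(by rewrite wE; case: abcd => -[_ _ _ ->])
      ltac:(by rewrite wE; case: abcd => -[-> _ _ ->])
      ltac:(by rewrite wE; case: abcd => -[_ -> _ ->]).
  by rewrite /D; move: jab; rewrite !inE => /orP[]/eqP->.
have gen x0 xc xd y0 yc yd :
    D (x0 *: E 0 + 1 *: (xc *: E c + xd *: E d)) (y0 *: E 0 + 1 *: (yc *: E c + yd *: E d))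
    = D (E 0) (E c) * (x0 * yc - y0 * xc) + D (E 0) (E d) * (x0 * yd - y0 * xd).
  rewrite !lD !lD' !DXX (aD (E c) (E 0)) (aD (E d) (E 0)) (aD (E d) (E c)) Dcd.
  by move: (D _ _) (D _ _) => *; ring.
rewrite /alt2 -gen -!expand //.
Qed.

Lemma form_trans (j : 'I_5) i i' v : mdom i p -> mdom i' p ->
  w j p i v = w j p i' (v *m jacobian (mcrd i' \o minv i) (mcrd i p)).
Proof.
by move=> ip ip'; have [_ fw _ _ _] := aw; have [cw _] := fw j;
   have [_ /(_ i' ip')] := cw p Up i ip.
Qed.

(** The coefficients are computed in one chart [i'] while the congruence holds in any chart [i], as
    [invariants] demands the same numbers in all charts. *)
Lemma congruent_pair i i' a b c d j x y : mdom i p -> mdom i' p ->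
  paired a b c d -> j \in [:: a; b] ->
  x = extd (w j) p i' (pr (dframe w p i' 0) (dframe w p i' c)) ->
  y = extd (w j) p i' (pr (dframe w p i' 0) (dframe w p i' d)) ->
  @congruent R 5 [:: w a p i; w b p i] 1 (extd (w j) p i)
    (x \*o wedge (w 0 p i) (w c p i) \+ y \*o wedge (w 0 p i) (w d p i)).
Proof.
move=> ip ip' abcd jab xE yE.
have wE := dframeP aw Up ip.
have lw k : islin (w k p i) by exact: adapted_islin aw Up ip k.
pose D X Y := extd (w j) p i (pr X Y) - (x * alt2 (w 0 p i) (w c p i) X Y +
   y * alt2 (w 0 p i) (w d p i) X Y).
apply: (@congruent_intro _ _ _ _ (dframe w p i a) (dframe w p i b) D) => //.
- by rewrite wE eqxx.
- by rewrite wE; case: abcd => -[-> -> _ _].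
- by rewrite wE; case: abcd => -[-> -> _ _].
- by rewrite wE eqxx.
- move=> X s t Y Z; rewrite /D.
  rewrite (extd_islin aw Up ip j X) !(alt2_islin X (lw _) (lw _)).
  by move: (extd _ _ _ _) (extd _ _ _ _) (alt2 _ _ _ _) (alt2 _ _ _ _)
     (alt2 _ _ _ _) (alt2 _ _ _ _) => *; ring.
- move=> X Y; rewrite /D extd_anti /alt2.
  by move: (extd _ _ _ _) => ?; ring.
- by move=> v; rewrite /D -!wedge_pr pr_rows.
move=> X Y Xa Xb Ya Yb; rewrite /D.
have [oU fw _ _ _] := aw.
set J := jacobian (mcrd i' \o minv i) (mcrd i p).
rewrite (extd_trans _ oU (fw j) Up ip ip') pr_mul -/J.
have tr k v : w k p i v = w k p i' (v *m J) by exact: form_trans.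
rewrite (adapted_dpair (i := i') ip' abcd jab) -?tr //.
by rewrite xE yE /alt2 !(tr _ X) !(tr _ Y) subrr.
Qed.

Lemma invariants_exist : exists S1 S2 : 'M[R]_2, invariants w p S1 S2.
Proof.
pose i' := chart_at p; have ip' : mdom i' p by exact: mem_chart_at.
pose T (j k : 'I_5) := extd (w j) p i' (pr (dframe w p i' 0) (dframe w p i' k)).
pose mx (x y z t : R) : 'M[R]_2 := \matrix_(r, s)
   if r == 0 then (if s == 0 then x else y) else (if s == 0 then z else t).
(* The eight coefficients [T] are sums and differences of entries of S_1 and S_2 taken in pairs;
   half-sums and half-differences invert the system. *)
exists (mx ((T 1 3 - T 4 2) / 2) ((T 1 4 + T 3 2) / 2)
           ((T 2 3 + T 4 1) / 2) ((T 2 4 - T 3 1) / 2)).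
exists (mx ((T 1 3 + T 4 2) / 2) ((T 1 4 - T 3 2) / 2)
           ((T 2 3 - T 4 1) / 2) ((T 2 4 + T 3 1) / 2)).
move=> i ip /=; rewrite !mxE /=.
have p1 : paired 1 2 3 4 by left.
have p3 : paired 3 4 1 2 by right.
split.
- by apply: (congruent_pair ip ip' p1); rewrite ?inE //; rewrite -/(T _ _); field.
- by apply: (congruent_pair ip ip' p1); rewrite ?inE //; rewrite -/(T _ _); field.
- by apply: (congruent_pair ip ip' p3); rewrite ?inE //; rewrite -/(T _ _); field.
- by apply: (congruent_pair ip ip' p3); rewrite ?inE //; rewrite -/(T _ _); field.
Qed.

End Coframing.
End Invariants.

(** * Coframes along a map *)

Section MovingFrame.
Variables (R : realType) (n : nat) (N : manifold R n) (M : manifold R 5).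
Variables (I : graded_set M) (f : N -> M) (W : set N) (u : N -> 'I_5 -> covector M 1).
Hypotheses (sf : smooth_map f) (oW : open W).
Hypothesis su : forall j, smooth_along f W (fun q => u q j).
Hypothesis Gu : forall q, W q -> G1 I (f q) (u q).
Variables (a : chart N) (i : chart M).

Let F : 'rV[R]_n -> 'rV[R]_5 := mcrd i \o f \o minv a.
Let O := img a (W `&` f @^-1` mdom i).

(** The target chart [i] is kept fixed. The chart used by [pullback] is chosen anew at each image
    point and may jump, so that expression cannot be differentiated directly. *)
Definition coframe_pullback j (z : 'rV[R]_n) (v : 'rV[R]_n) : R :=
  u (minv a z) j i ('D_v (mcrd i \o f \o minv a) z).
Let al := coframe_pullback.

Let oO : open O.
Proof.
apply: img_open; apply: openI => //; have [cf _] := sf.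
by apply: open_comp; [move=> q _; exact: cf|exact: mdom_open].
Qed.

Let sF : smooth_on O F.
Proof.
have [_ /(_ a i) sfai] := sf; apply: smooth_sub sfai => z [q [aq [Wq iq]] <-].
by exists q.
Qed.

Let Fz z : O z -> minv i (F z) = f (minv a z).
Proof. by move=> /imgP[_ [[_ iz] _]]; rewrite /F /= mcrdK. Qed.

Let u_islin z j : O z -> islin (u (minv a z) j i).
Proof.
move=> /imgP[_ [[Wz iz] _]]; have [U [w [aw Up uw]]] := Gu Wz.
have -> : u (minv a z) j i = w j (f (minv a z)) i.
  by apply/funext => v; rewrite uw.
exact: adapted_islin aw Up iz j.
Qed.

Let u_smooth j v : smooth_on O (fun z => u (minv a z) j i v).
Proof.
by apply: smooth_sub (su j a i v) => z [q [aq [Wq iq]] <-]; exists q.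
Qed.

Lemma coframe_pullback_smooth j v : smooth_on O ((al j)^~ v).
Proof.
apply: (@smooth_pullback R n 5 O F oO sF (fun z => u (minv a z) j i) v).
  exact: u_smooth.
by move=> z Oz; exact: u_islin.
Qed.

Lemma coframe_pullback_islin j z : O z -> islin (al j z).
Proof.
move=> Oz x y X Y; rewrite /al /coframe_pullback -/F.
have dF := smooth_diff sF Oz.
by rewrite !(deriveE _ dF) linearD !linearZ; exact: u_islin.
Qed.

(** The covector transforms by the Jacobian of the transition map, and the chain rule absorbs that
    Jacobian into the tangent map. *)
Lemma pullback_chart z j v : O z ->
  pullback f (minv a z) (u (minv a z) j) a v = al j z v.
Proof.
move=> Oz; have /imgP[_ [[Wz iz] [az zE]]] := Oz.
have [U [w [aw Up uw]]] := Gu Wz.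
pose i0 := chart_at (f (minv a z)); have i0z : mdom i0 (f (minv a z)) by exact: mem_chart_at.
rewrite /pullback /al /coframe_pullback -/F -/i0 -!uw // (form_trans aw Up j _ iz i0z).
congr (w j _ _ _); rewrite /tangent -/i0 zE.
have dF := smooth_diff sF Oz.
have dT : differentiable (mcrd i0 \o minv i) (mcrd i (f (minv a z))).
  by apply: (smooth_diff (@mtrans_smooth _ _ M i i0)); exact: mem_img.
have dG : differentiable (mcrd i0 \o f \o minv a) z.
  have [_ /(_ a i0) s0] := sf; apply: (smooth_diff s0).
  by rewrite -[X in _ X]zE; exists (minv a z).
rewrite -(deriveEjacobian _ dG) -(deriveEjacobian _ dT).
have -> : 'D_v (mcrd i0 \o f \o minv a) z = 'D_v ((mcrd i0 \o minv i) \o F) z.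
  apply: near_eq_derive; apply: filterS (open_nbhs_nbhs (conj oO Oz)) => y Oy.
  by rewrite /= Fz.
have dT' : differentiable (mcrd i0 \o minv i) (F z) by [].
rewrite (deriveE v (differentiable_comp dF dT')) (diff_comp dF dT') /=.
by rewrite -(deriveE v dF) -(deriveE _ dT').
Qed.

Section AtPoint.
Variable q : N.
Hypotheses (Wq : W q) (aq : mdom a q) (iq : mdom i (f q)).
Let y := mcrd a q.
Let Oy : O y. Proof. exact: mem_img. Qed.
Let yE : minv a y = q. Proof. by rewrite /y mcrdK. Qed.

(** The pulled-back coframe agrees at [y] with the pull-back of a fixed coframing [w], but not
    nearby. The transition matrix is continuous, block-shaped near [y] and the identity at [y], so
    on the appropriate kernels the exterior derivatives coincide. *)
Lemma moving_frame : exists U (w : 'I_5 -> form M 1),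
  [/\ extends_coframe I U w (f q) (u q),
      forall j X, w j (f q) i ('D_X F y) = al j y X,
      forall X Y, al 0 y X = 0 -> al 0 y Y = 0 ->
        dcf (al 0) y X Y = extd (w 0) (f q) i (pr ('D_X F y) ('D_Y F y))
    & forall b c d e j X Y, paired b c d e -> j \in [:: b; c] ->
        al b y X = 0 -> al c y X = 0 -> al b y Y = 0 -> al c y Y = 0 ->
        dcf (al j) y X Y = extd (w j) (f q) i (pr ('D_X F y) ('D_Y F y))].
Proof.
have [U [w [aw Up uw]]] := Gu Wq; exists U, w.
have [oU fw _ _ _] := aw.
have alw j X : w j (f q) i ('D_X F y) = al j y X.
  by rewrite /al /coframe_pullback yE uw.
pose A := img a (W `&` f @^-1` (mdom i `&` U)).
have oA : open A.
  apply: img_open; apply: openI => //; have [cf _] := sf.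
  apply: open_comp; first by move=> ? _; exact: cf.
  by apply: openI => //; exact: mdom_open.
have Ay : A y by exact: mem_img.
have AO z : A z -> O z by move=> [r [ar [Wr [ir _]]] <-]; exact: mem_img.
have nearA := open_nbhs_nbhs (conj oA Ay).
pose B := img i U; have oB : open B by exact: img_open.
have AB z : A z -> B (F z).
  by move=> /imgP[_ [[_ [iz Uz]] _]]; exact: mem_img.
have sFA : smooth_on A F by apply: smooth_sub sF.
have lw z k : B z -> islin (w k (minv i z) i).
  by move=> /imgP[_ [Uz [iz _]]]; exact: form_islin (fw k) Uz iz.
pose wh k z v := w k (minv i (F z)) i ('D_v F z).
have dwh k X Y : dcf (wh k) y X Y = extd (w k) (f q) i (pr ('D_X F y) ('D_Y F y)).
  rewrite extd1 row_pr0 row_pr1.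
  have -> : mcrd i (f q) = F y by rewrite /F /= yE.
  apply: (@dcf_pullback R n 5 A B F (fun z v => w k (minv i z) i v)) => //.
    by move=> v; exact: form_smooth (fw k).
  by move=> z Bz; exact: lw.
have swh k v : differentiable ((wh k)^~ v) y.
  apply: (@differentiable_pullback R n 5 A B F (fun z v => w k (minv i z) i v)) => //.
    by move=> v'; exact: form_smooth (fw k).
  by move=> z Bz; exact: lw.
pose g k j z := (invmx (coef (fun l => w l (minv i (F z)) i)) *m
  coef (fun l => u (minv a z) l i)) k j.
have By : B (F y) by exact: AB.
have cF : {for y, continuous F} by exact: smooth_continuous sF Oy.
have pE : minv i (F y) = f q by rewrite Fz // yE.
have Ufq : U (f q) by [].
have cg k j : {for y, continuous (g k j)}.
  apply: (@gauge_mx_continuous R _ 5 (fun z l => w l (minv i (F z)) i)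
    (fun z l => u (minv a z) l i)).
  - by rewrite pE; exact: adapted_unit aw Ufq iq.
  - move=> l v; apply: (@continuous_comp _ _ _ F (fun z => w l (minv i z) i v)) => //.
    exact: smooth_continuous (form_smooth i v (fw l)) By.
  - by move=> l v; exact: smooth_continuous (u_smooth l v) Oy.
have gy k j : g k j y = (k == j)%:R.
  rewrite /g coef_mul; last exact: u_islin.
  by rewrite yE -uw // pE; exact: dframeP aw Ufq iq k j.
(* The coframing [w'] depends on [z] with no control. It only serves to recognize [g] at [z] as a
   [gauge] matrix; continuity comes from the formula for [g]. *)
have gE z : A z -> exists U' w', [/\ adapted_coframing I U' w', U' (f (minv a z)),
    forall k j, g k j z = gauge w w' (f (minv a z)) i k j
  & forall j v, al j z v = w' j (f (minv a z)) i ('D_v F z)].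
  move=> Az; have /imgP[_ [[Wz [iz Uz]] [az zE]]] := Az.
  have [U' [w' [aw' Up' uw']]] := Gu Wz; exists U', w'; split=> // [k j|j v].
    rewrite /g coef_mul; last by apply: u_islin; exact: AO.
    by rewrite -uw' // Fz //; exact: AO.
  by rewrite /al /coframe_pullback uw'.
have whE k z v : A z -> wh k z v = w k (f (minv a z)) i ('D_v F z).
  by move=> Az; rewrite /wh Fz //; exact: AO.
have wal k X : wh k y X = al k y X.
  by rewrite whE // yE alw.
split => //.
- move=> X Y X0 Y0.
  rewrite (@dcf_sum_null R n 5 (pred1 0) (al 0) wh (fun k => g k 0)) => //.
  + by rewrite big_pred1_eq gy mul1r dwh.
  + apply: filterS nearA => z Az v; rewrite big_pred1_eq.
    have /imgP[_ [[Wz [iz Uz]] [az zE]]] := Az.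
    have [U' [w' [aw' U'p gz ->]]] := gE z Az.
    by rewrite gz whE // (gauge_expand0 aw aw').
  + by move=> k /eqP->; rewrite wal.
  + by move=> k /eqP->; rewrite wal.
- move=> b c d e j X Y bcde jbc bX cX bY cY.
  have bc : b != c by case: bcde => -[-> -> _ _].
  (* The minor equals 1 at [y], so the exchange of the two systems is excluded near [y]. *)
  have nearm : \forall z \near y, g b b z * g c c z - g c b z * g b c z != 0.
    have m1 : g b b y * g c c y - g c b y * g b c y != 0.
      by rewrite !gy !eqxx (negbTE bc) mulr0 subr0 mulr1 oner_eq0.
    apply: (@cvgr_neq0 _ _ _ (nbhs y) _ _ _ _ m1).
    exact: (cvgB (cvgM (cg b b) (cg c c)) (cvgM (cg c b) (cg b c))).
  rewrite (@dcf_sum_null R n 5 [pred k | k \in [:: b; c]] (al j) wh (fun k => g k j)) => //.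
  + rewrite (bigD1 j) //= big1 ?addr0 => [|k /andP[_ kj]].
      by rewrite gy eqxx mul1r dwh.
    by rewrite gy (negbTE kj) mul0r.
  + apply: filterS (filterI nearA nearm) => z [Az mz] v.
    have /imgP[_ [[Wz [iz Uz]] [az zE]]] := Az.
    have [U' [w' [aw' U'p gz ->]]] := gE z Az.
    rewrite (gauge_expand_pair (i := i) aw aw' _ Uz U'p iz bcde) //.
      by apply: eq_bigr => k _; rewrite gz whE.
    by rewrite /minor -!gz.
  + by move=> k; rewrite !inE => /orP[]/eqP->; rewrite wal.
  + by move=> k; rewrite !inE => /orP[]/eqP->; rewrite wal.
Qed.

Lemma pullback_d0 X Y : al 0 y X = 0 -> al 0 y Y = 0 ->
  dcf (al 0) y X Y = alt2 (al 1 y) (al 2 y) X Y + alt2 (al 3 y) (al 4 y) X Y.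
Proof.
have [U [w [[aw Up uw] alw d0 _]]] := moving_frame; move=> X0 Y0.
by rewrite d0 // (adapted_d0 aw Up iq) ?alw // /alt2 !alw.
Qed.

Lemma pullback_da b c d e j X Y : paired b c d e -> j \in [:: b; c] ->
  al 0 y X = 0 -> al b y X = 0 -> al c y X = 0 ->
  al 0 y Y = 0 -> al b y Y = 0 -> al c y Y = 0 ->
  dcf (al j) y X Y = 0.
Proof.
have [U [w [[aw Up uw] alw _ da]]] := moving_frame => bcde jbc X0 Xb Xc Y0 Yb Yc.
rewrite (da b c d e) //.
have [] := adapted_da (X := 'D_X F y) (Y := 'D_Y F y) aw Up iq bcde; rewrite ?alw //.
by move: jbc; rewrite !inE => /orP[]/eqP->.
Qed.

Lemma pullback_invariants : exists S1 S2 : 'M[R]_2,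
  [/\ V_at I (f q) (u q) S1 S2,
      forall X Y, al 1 y X = 0 -> al 2 y X = 0 -> al 1 y Y = 0 -> al 2 y Y = 0 ->
        dcf (al 1) y X Y = (S1 0 0 + S2 0 0) * alt2 (al 0 y) (al 3 y) X Y +
          (S1 0 1 + S2 0 1) * alt2 (al 0 y) (al 4 y) X Y /\
        dcf (al 2) y X Y = (S1 1 0 + S2 1 0) * alt2 (al 0 y) (al 3 y) X Y +
          (S1 1 1 + S2 1 1) * alt2 (al 0 y) (al 4 y) X Y
    & forall X Y, al 3 y X = 0 -> al 4 y X = 0 -> al 3 y Y = 0 -> al 4 y Y = 0 ->
        dcf (al 3) y X Y = (S2 1 1 - S1 1 1) * alt2 (al 0 y) (al 1 y) X Y +
          (S1 0 1 - S2 0 1) * alt2 (al 0 y) (al 2 y) X Y].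
Proof.
have [U [w [uext alw _ da]]] := moving_frame; have [aw Up uw] := uext.
have [S1 [S2 inv]] := invariants_exist aw Up; exists S1, S2.
have [c1 c2 c3 c4] := inv i iq.
have p1 : paired 1 2 3 4 by left.
have p3 : paired 3 4 1 2 by right.
have ker2 j k X : al j y X = 0 -> al k y X = 0 ->
    forall l, (l < 2)%N -> nth (fun=> 0) [:: w j (f q) i; w k (f q) i] l ('D_X F y) = 0.
  by move=> Xj Xk [|[|//]] _ /=; rewrite alw.
split; first by exists U, w.
- move=> X Y X1 X2 Y1 Y2.
  rewrite !(da 1 2 3 4) ?inE // (congruent_ker c1 (ker2 _ _ _ X1 X2) (ker2 _ _ _ Y1 Y2)).
  rewrite (congruent_ker c2 (ker2 _ _ _ X1 X2) (ker2 _ _ _ Y1 Y2)) /=.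
  by rewrite !wedge_pr /alt2 !alw.
- move=> X Y X3 X4 Y3 Y4.
  rewrite (da 3 4 1 2) ?inE // (congruent_ker c3 (ker2 _ _ _ X3 X4) (ker2 _ _ _ Y3 Y4)) /=.
  by rewrite !wedge_pr /alt2 !alw.
Qed.

End AtPoint.
End MovingFrame.

(** * The trace relation *)

Section Trace.
Variables (R : realType) (n : nat) (O : set 'rV[R]_n) (y : 'rV[R]_n).
Variable al : 'I_5 -> 'rV[R]_n -> 'rV[R]_n -> R.
Hypotheses (oO : open O) (Oy : O y).
Hypothesis sal : forall j v, smooth_on O ((al j)^~ v).
Hypothesis lal : forall j z, O z -> islin (al j z).
Hypothesis d0 : forall z X Y, O z -> al 0 z X = 0 -> al 0 z Y = 0 ->
  dcf (al 0) z X Y = alt2 (al 1 z) (al 2 z) X Y + alt2 (al 3 z) (al 4 z) X Y.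
Hypothesis d4 : forall X Y, al 0 y X = 0 -> al 3 y X = 0 -> al 4 y X = 0 ->
  al 0 y Y = 0 -> al 3 y Y = 0 -> al 4 y Y = 0 -> dcf (al 4) y X Y = 0.
Variable A : 'I_5 -> 'rV[R]_n.
Hypothesis dual : forall j k, al j y (A k) = (k == j)%:R.

Let D j X Y := 'D_X ((al j)^~ Y) y.
Let Theta z X Y := dcf (al 0) z X Y -
  (alt2 (al 1 z) (al 2 z) X Y + alt2 (al 3 z) (al 4 z) X Y).

Let sdcf X Y : smooth_on O (fun z => dcf (al 0) z X Y).
Proof.
apply: (@smooth_ext _ _ _ _ (fun z => 'D_X ((al 0)^~ Y) z + (- 1) * 'D_Y ((al 0)^~ X) z)) => //.
  by move=> z _; rewrite mulN1r.
apply: smoothD => //; first exact: smooth_derive.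
by apply: smoothM => //; [exact: smooth_cst|exact: smooth_derive].
Qed.

Let salt j k X Y : smooth_on O (fun z => alt2 (al j z) (al k z) X Y).
Proof.
apply: (@smooth_ext _ _ _ _ (fun z => al j z X * al k z Y + (- 1) * (al j z Y * al k z X))) => //.
  by move=> z _; rewrite mulN1r.
apply: smoothD => //; first exact: smoothM.
by apply: smoothM => //; [exact: smooth_cst|exact: smoothM].
Qed.

Let sTheta X Y : smooth_on O (fun z => Theta z X Y).
Proof.
apply: (@smooth_ext _ _ _ _ (fun z => dcf (al 0) z X Y +
   (- 1) * (alt2 (al 1 z) (al 2 z) X Y + alt2 (al 3 z) (al 4 z) X Y))) => //.
  by move=> z _; rewrite mulN1r.
apply: smoothD => //; apply: smoothM => //; first exact: smooth_cst.
exact: smoothD.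
Qed.

Let Theta_anti z X Y : Theta z X Y = - Theta z Y X.
Proof. by rewrite /Theta dcf_anti /alt2; move: (dcf _ _ _ _) => ?; ring. Qed.

Let Theta_lin z X : O z -> islin (Theta z X).
Proof.
move=> Oz a b Y Z; rewrite /Theta.
have -> : dcf (al 0) z X (a *: Y + b *: Z) = a * dcf (al 0) z X Y + b * dcf (al 0) z X Z.
  apply: (dcf_islin (w := al 0)) => [v|].
    exact: smooth_diff (sal 0 v) Oz.
  by apply: filterS (open_nbhs_nbhs (conj oO Oz)) => z' Oz'; exact: lal.
rewrite !(alt2_islin X (lal _ Oz) (lal _ Oz)).
move: (dcf _ _ _ _) (dcf _ _ _ _) (alt2 _ _ _ _) (alt2 _ _ _ _) (alt2 _ _ _ _) (alt2 _ _ _ _).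
by move=> *; ring.
Qed.

Let Theta0 z X Y : O z -> al 0 z X = 0 -> al 0 z Y = 0 -> Theta z X Y = 0.
Proof. by move=> Oz X0 Y0; rewrite /Theta d0 // subrr. Qed.

(* [Theta] is a multiple of [al 0], i.e. [al 0 /\ Theta = 0]. *)
Let Theta_wedge z E X Y : O z -> al 0 z E != 0 ->
  al 0 z E * Theta z X Y = al 0 z Y * Theta z X E + al 0 z X * Theta z E Y.
Proof.
move=> Oz E0.
have l0 := lal 0 Oz.
have lT Z := Theta_lin Z Oz.
have lT' Z a b X' Y' : Theta z (a *: X' + b *: Y') Z = a * Theta z X' Z + b * Theta z Y' Z.
  by rewrite Theta_anti lT (Theta_anti _ X') (Theta_anti _ Y'); ring.
have TEE : Theta z E E = 0 by have := Theta_anti z E E; lra.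
have H : Theta z (al 0 z E *: X + - al 0 z X *: E) (al 0 z E *: Y + - al 0 z Y *: E) = 0.
  by apply: Theta0 => //; rewrite l0; ring.
move: H; rewrite lT !lT' TEE => H.
by apply: (mulfI E0); move: H; move: (Theta z _ _) (Theta z _ _) (Theta z _ _) => *; lra.
Qed.

Let derivT X Y Z : derivable (fun z => Theta z X Y) y Z.
Proof. exact: smooth_derivable (sTheta X Y) Oy. Qed.

Let derival j X Z : derivable ((al j)^~ X) y Z.
Proof. exact: smooth_derivable (sal j X) Oy. Qed.

Let derive_prod (F G : 'rV[R]_n -> R) Z : derivable F y Z -> derivable G y Z ->
  'D_Z (fun z => F z * G z) y = F y * 'D_Z G y + G y * 'D_Z F y.
Proof. exact: deriveM. Qed.

Let derivable_prod (F G : 'rV[R]_n -> R) Z : derivable F y Z -> derivable G y Z ->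
  derivable (fun z => F z * G z) y Z.
Proof. exact: derivableM. Qed.

Let derive_add (F G : 'rV[R]_n -> R) Z : derivable F y Z -> derivable G y Z ->
  'D_Z (fun z => F z + G z) y = 'D_Z F y + 'D_Z G y.
Proof. exact: deriveD. Qed.

Let derive_sub (F G : 'rV[R]_n -> R) Z : derivable F y Z -> derivable G y Z ->
  'D_Z (fun z => F z - G z) y = 'D_Z F y - 'D_Z G y.
Proof. exact: deriveB. Qed.

(** Differentiating [Theta_wedge] with [E = A 0]: as [al 0] and [Theta] vanish on the arguments at
    [y], only derivatives of [al 0] times contractions of [Theta] with [A 0] remain. *)
Let derive_Theta X Y Z : al 0 y X = 0 -> al 0 y Y = 0 ->
  'D_Z (fun z => Theta z X Y) y =
  D 0 Z Y * Theta y X (A 0) - D 0 Z X * Theta y Y (A 0).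
Proof.
move=> X0 Y0; set E := A 0.
have E1 : al 0 y E = 1 by rewrite dual.
have nearE : \forall z \near y, O z /\ al 0 z E != 0.
  apply: filterI; first exact: open_nbhs_nbhs.
  have E0 : al 0 y E != 0 by rewrite E1 oner_eq0.
  exact: (@cvgr_neq0 _ _ _ (nbhs y) _ _ _ (smooth_continuous (sal 0 E) Oy) E0).
have : 'D_Z (fun z => al 0 z E * Theta z X Y) y =
    'D_Z (fun z => al 0 z Y * Theta z X E + al 0 z X * Theta z E Y) y.
  by apply: near_eq_derive; apply: filterS nearE => z [Oz Ez]; exact: Theta_wedge.
rewrite (derive_prod (@derival 0 E Z) (@derivT X Y Z)).
rewrite (derive_add (derivable_prod (@derival 0 Y Z) (@derivT X E Z))
  (derivable_prod (@derival 0 X Z) (@derivT E Y Z))).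
rewrite (derive_prod (@derival 0 Y Z) (@derivT X E Z))
  (derive_prod (@derival 0 X Z) (@derivT E Y Z)).
rewrite E1 X0 Y0 (Theta0 Oy X0 Y0) (Theta_anti y E Y) -/(D 0 Z Y) -/(D 0 Z X).
rewrite !mul0r !add0r addr0 mul1r => ->.
by move: (D 0 Z Y) (D 0 Z X) (Theta y X E) (Theta y Y E) => *; ring.
Qed.

Let D2 Z X Y := 'D_Z ('D_X ((al 0)^~ Y)) y.

Let D2C Z X Y : D2 Z X Y = D2 X Z Y.
Proof. exact: (derive_comm X Z oO Oy (sal 0 Y)). Qed.

Let derive_alt j k X Y Z : 'D_Z (fun z => alt2 (al j z) (al k z) X Y) y =
  al j y X * D k Z Y + al k y Y * D j Z X - (al j y Y * D k Z X + al k y X * D j Z Y).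
Proof.
rewrite [LHS](derive_sub (derivable_prod (@derival j X Z) (@derival k Y Z))
  (derivable_prod (@derival j Y Z) (@derival k X Z))).
by rewrite (derive_prod (@derival j X Z) (@derival k Y Z))
  (derive_prod (@derival j Y Z) (@derival k X Z)).
Qed.

Let derive_Theta' X Y Z : 'D_Z (fun z => Theta z X Y) y =
  D2 Z X Y - D2 Z Y X
  - (al 1 y X * D 2 Z Y + al 2 y Y * D 1 Z X - (al 1 y Y * D 2 Z X + al 2 y X * D 1 Z Y))
  - (al 3 y X * D 4 Z Y + al 4 y Y * D 3 Z X - (al 3 y Y * D 4 Z X + al 4 y X * D 3 Z Y)).
Proof.
have da j k := smooth_derivable (v := Z) (salt j k X Y) Oy.
have dd := smooth_derivable (v := Z) (sdcf X Y) Oy.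
have ds T S := smooth_derivable (v := Z) (smooth_derive T (sal 0 S)) Oy.
rewrite [LHS](derive_sub dd (derivableD (da 1 2) (da 3 4))).
rewrite [X in X - _ = _](derive_sub (ds X Y) (ds Y X)).
rewrite [X in _ - X = _](derive_add (da 1 2) (da 3 4)) !derive_alt.
by rewrite -/(D2 Z X Y) -/(D2 Z Y X) opprD addrA.
Qed.

(* The closedness of [d(al 0)], evaluated on [A 1], [A 2], [A 3]. *)
Lemma trace_relation :
  dcf (al 0) y (A 3) (A 0) = dcf (al 1) y (A 3) (A 1) + dcf (al 2) y (A 3) (A 2).
Proof.
have dE j X Y : dcf (al j) y X Y = D j X Y - D j Y X by [].
have A0 k : al 0 y (A k) = (k == 0)%:R by [].
(* The three cyclic derivatives of [Theta] are computed both from its definition and from its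
   divisibility by [al 0]; in the sum, symmetry cancels all second derivatives of [al 0]. *)
have := derive_Theta' (A 2) (A 3) (A 1); rewrite derive_Theta ?A0 //.
have := derive_Theta' (A 3) (A 1) (A 2); rewrite derive_Theta ?A0 //.
have := derive_Theta' (A 1) (A 2) (A 3); rewrite derive_Theta ?A0 //.
rewrite (D2C (A 3) (A 1)) (D2C (A 3) (A 2)) (D2C (A 2) (A 1)).
have := d0 (X := A 1) (Y := A 2) Oy; rewrite !dual => /(_ erefl erefl).
have := d0 (X := A 1) (Y := A 3) Oy; rewrite !dual => /(_ erefl erefl).
have := d0 (X := A 2) (Y := A 3) Oy; rewrite !dual => /(_ erefl erefl).
have := d4 (X := A 1) (Y := A 2); rewrite !dual => /(_ erefl erefl erefl erefl erefl erefl).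
have : Theta y (A 3) (A 0) = dcf (al 0) y (A 3) (A 0).
  by rewrite /Theta /alt2 !dual /= !(mulr0, mul0r, subr0, addr0).
rewrite /alt2 !dual !dE /=.
move: (Theta y (A 1) (A 0)) (Theta y (A 2) (A 0)) (Theta y (A 3) (A 0)).
move: (D2 (A 1) (A 2) (A 3)) (D2 (A 1) (A 3) (A 2)) (D2 (A 2) (A 3) (A 1)).
move: (D 0 (A 1) (A 2)) (D 0 (A 2) (A 1)) (D 0 (A 1) (A 3)) (D 0 (A 3) (A 1)).
move: (D 0 (A 2) (A 3)) (D 0 (A 3) (A 2)) (D 4 (A 1) (A 2)) (D 4 (A 2) (A 1)).
move: (D 0 (A 3) (A 0)) (D 0 (A 0) (A 3)) (D 1 (A 3) (A 1)) (D 1 (A 1) (A 3)).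
move: (D 2 (A 3) (A 2)) (D 2 (A 2) (A 3)).
move=> d232 d223 d030 d003 d131 d113 d023 d032 d412 d421 d012 d021 d013 d031 ? ? ? t1 t2 t3.
repeat match goal with |- context [D ?j ?X ?Y] => move: (D j X Y) => ? end.
move=> et3 e4 e23 e13 e12.
(* These three equations are the values of d([al 0]) on [A 1, A 2, A 3], namely 0, 0 and 1. After
   substitution the products with [Theta] match and linear arithmetic suffices. *)
have -> : d023 = d032 by lra.
have -> : d013 = d031 by lra.
have -> : d012 = d021 + 1 by lra.
by move=> h1 h2 h3; lra.
Qed.

End Trace.

(** * Special transformations *)

Lemma ord5_ind (P : 'I_5 -> Prop) : P 0 -> P 1 -> P 2 -> P 3 -> P 4 -> forall j, P j.
Proof.
move=> P0 P1 P2 P3 P4 [[|[|[|[|[|//]]]]] lt5];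
  [move: P0|move: P1|move: P2|move: P3|move: P4]; congr P; exact: val_inj.
Qed.

Section SpecialRelations.
Variables (R : realType) (n : nat) (O : set 'rV[R]_n) (y : 'rV[R]_n).
Variables (al be : 'I_5 -> 'rV[R]_n -> 'rV[R]_n -> R) (s t : 'rV[R]_n -> R).
Hypotheses (oO : open O) (Oy : O y).
Hypothesis sal : forall j v, smooth_on O ((al j)^~ v).
Hypothesis sbe : forall j v, smooth_on O ((be j)^~ v).
Hypothesis lal : forall j z, O z -> islin (al j z).
Hypothesis lbe : forall j z, O z -> islin (be j z).
Hypothesis dal0 : forall z X Y, O z -> al 0 z X = 0 -> al 0 z Y = 0 ->
  dcf (al 0) z X Y = alt2 (al 1 z) (al 2 z) X Y + alt2 (al 3 z) (al 4 z) X Y.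
Hypothesis dbe0 : forall z X Y, O z -> be 0 z X = 0 -> be 0 z Y = 0 ->
  dcf (be 0) z X Y = alt2 (be 1 z) (be 2 z) X Y + alt2 (be 3 z) (be 4 z) X Y.
Hypothesis dal4 : forall X Y, al 0 y X = 0 -> al 3 y X = 0 -> al 4 y X = 0 ->
  al 0 y Y = 0 -> al 3 y Y = 0 -> al 4 y Y = 0 -> dcf (al 4) y X Y = 0.
Hypothesis dbe4 : forall X Y, be 0 y X = 0 -> be 3 y X = 0 -> be 4 y X = 0 ->
  be 0 y Y = 0 -> be 3 y Y = 0 -> be 4 y Y = 0 -> dcf (be 4) y X Y = 0.
Hypothesis ds : differentiable s y.
Hypothesis be1 : forall z v, O z -> be 1 z v = al 1 z v.
Hypothesis be2 : forall z v, O z -> be 2 z v = al 2 z v + s z * (al 0 z v + be 0 z v).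
Hypothesis be3 : forall z v, O z -> be 3 z v = al 3 z v.
Hypothesis be4 : forall z v, O z -> be 4 z v = - al 4 z v + t z * (be 0 z v - al 0 z v).
Variables V W : 'M[R]_2.
Hypothesis invV12 : forall X Y, al 1 y X = 0 -> al 2 y X = 0 -> al 1 y Y = 0 -> al 2 y Y = 0 ->
  dcf (al 1) y X Y = V 0 0 * alt2 (al 0 y) (al 3 y) X Y + V 0 1 * alt2 (al 0 y) (al 4 y) X Y /\
  dcf (al 2) y X Y = V 1 0 * alt2 (al 0 y) (al 3 y) X Y + V 1 1 * alt2 (al 0 y) (al 4 y) X Y.
Hypothesis invV3 : forall X Y, al 3 y X = 0 -> al 4 y X = 0 -> al 3 y Y = 0 -> al 4 y Y = 0 ->
  dcf (al 3) y X Y = - V 1 1 * alt2 (al 0 y) (al 1 y) X Y + V 0 1 * alt2 (al 0 y) (al 2 y) X Y.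
Hypothesis invW12 : forall X Y, be 1 y X = 0 -> be 2 y X = 0 -> be 1 y Y = 0 -> be 2 y Y = 0 ->
  dcf (be 1) y X Y = W 0 0 * alt2 (be 0 y) (be 3 y) X Y + W 0 1 * alt2 (be 0 y) (be 4 y) X Y /\
  dcf (be 2) y X Y = W 1 0 * alt2 (be 0 y) (be 3 y) X Y + W 1 1 * alt2 (be 0 y) (be 4 y) X Y.
Hypothesis invW3 : forall X Y, be 3 y X = 0 -> be 4 y X = 0 -> be 3 y Y = 0 -> be 4 y Y = 0 ->
  dcf (be 3) y X Y = - W 1 1 * alt2 (be 0 y) (be 1 y) X Y + W 0 1 * alt2 (be 0 y) (be 2 y) X Y.
Variables (A : 'I_5 -> 'rV[R]_n) (B0 : 'rV[R]_n).
Hypothesis alA : forall j k, al j y (A k) = (k == j)%:R.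
Hypothesis alB0 : forall j, al j y B0 = 0.
Hypothesis beA : forall k, be 0 y (A k) = 0.
Hypothesis beB0 : be 0 y B0 = 1.

(** [F0] is the dual vector of [be 0] in the coframe [be]: it is killed by [al 0 + be 0], and the
    coefficient [2 * t y] gives [be 4 F0 = 0]. Likewise [G0] is killed by [be 0 - al 0]. The nested
    two-term combinations fit the shape of [islin]. *)
Let F0 := 1 *: (1 *: B0 + (- 1) *: A 0) + (2 * t y) *: A 4.
Let G0 := 1 *: A 0 + 1 *: B0.

Let nearO := open_nbhs_nbhs (conj oO Oy).

Let dbe1 X Y : dcf (be 1) y X Y = dcf (al 1) y X Y.
Proof. by apply: dcf_near; apply: filterS nearO => z Oz; apply/funext => v; exact: be1. Qed.

Let dbe3 X Y : dcf (be 3) y X Y = dcf (al 3) y X Y.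
Proof. by apply: dcf_near; apply: filterS nearO => z Oz; apply/funext => v; exact: be3. Qed.

(** On vectors killed by [al 0 + be 0] the term with the derivative of [s] disappears. *)
Let dbe2 X Y : al 0 y X + be 0 y X = 0 -> al 0 y Y + be 0 y Y = 0 ->
  dcf (be 2) y X Y = dcf (al 2) y X Y + s y * (dcf (al 0) y X Y + dcf (be 0) y X Y).
Proof.
have half X' Y' : al 0 y Y' + be 0 y Y' = 0 -> 'D_X' ((be 2)^~ Y') y =
    'D_X' ((al 2)^~ Y') y + s y * ('D_X' ((al 0)^~ Y') y + 'D_X' ((be 0)^~ Y') y).
  move=> Y0.
  have d2 : derivable ((al 2)^~ Y') y X' by exact: smooth_derivable (sal 2 Y') Oy.
  have d0 : derivable ((al 0)^~ Y') y X' by exact: smooth_derivable (sal 0 Y') Oy.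
  have d0' : derivable ((be 0)^~ Y') y X' by exact: smooth_derivable (sbe 0 Y') Oy.
  have d_s : derivable s y X' by exact: diff_derivable.
  have dsig := derivableD d0 d0'.
  have -> : 'D_X' ((be 2)^~ Y') y =
      'D_X' ((al 2)^~ Y' + s * ((al 0)^~ Y' + (be 0)^~ Y')) y.
    by apply: near_eq_derive; apply: filterS nearO => z Oz; exact: be2.
  rewrite (deriveD d2 (derivableM d_s dsig)) (deriveM d_s dsig) (deriveD d0 d0').
  have -> : ((al 0)^~ Y' + (be 0)^~ Y') y = 0 by exact: Y0.
  by rewrite scale0r addr0.
move=> X0 Y0; rewrite /dcf (half _ _ X0) (half _ _ Y0).
move: ('D_X _ y) ('D_X _ y) ('D_X _ y) ('D_Y _ y) ('D_Y _ y) ('D_Y _ y).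
by move=> *; ring.
Qed.

Let linF j : al j y F0 = - al j y (A 0) + 2 * t y * al j y (A 4).
Proof. by rewrite /F0 !(lal j Oy) alB0; ring. Qed.

Let be0F : be 0 y F0 = 1.
Proof. by rewrite /F0 !(lbe 0 Oy) !beA beB0; ring. Qed.

Let linG j : al j y G0 = al j y (A 0).
Proof. by rewrite /G0 !(lal j Oy) alB0; ring. Qed.

Let be0G : be 0 y G0 = 1.
Proof. by rewrite /G0 !(lbe 0 Oy) !beA beB0; ring. Qed.

Ltac values := rewrite ?(be1 _ Oy, be2 _ Oy, be3 _ Oy, be4 _ Oy)
  ?(linF, be0F, linG, be0G) ?alA ?beA /=.
Ltac vanish := by values; ring.

(** The values -1 of [al 0] and 1 of [be 0] on [F0] reverse the sign of the first entry; for the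
    second entry the value -1 of [be 4] on [A 4] reverses it again. *)
Lemma special_W12 : W 0 0 = - V 0 0 /\ W 0 1 = V 0 1.
Proof.
have [a3 _] := invV12 (X := A 3) (Y := F0) ltac:(vanish) ltac:(vanish) ltac:(vanish) ltac:(vanish).
have [b3 _] := invW12 (X := A 3) (Y := F0) ltac:(vanish) ltac:(vanish) ltac:(vanish) ltac:(vanish).
have [a4 _] := invV12 (X := A 4) (Y := F0) ltac:(vanish) ltac:(vanish) ltac:(vanish) ltac:(vanish).
have [b4 _] := invW12 (X := A 4) (Y := F0) ltac:(vanish) ltac:(vanish) ltac:(vanish) ltac:(vanish).
move: b3 b4; rewrite !dbe1 a3 a4 /alt2; values.
by move=> ? ?; split; lra.
Qed.

(** On [G0] both contact forms take the value 1, so no sign appears. *)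
Lemma special_W4 : W 1 1 = V 1 1.
Proof.
have a1 := invV3 (X := A 1) (Y := G0) ltac:(vanish) ltac:(vanish) ltac:(vanish) ltac:(vanish).
have b1 := invW3 (X := A 1) (Y := G0) ltac:(vanish) ltac:(vanish) ltac:(vanish) ltac:(vanish).
move: b1; rewrite dbe3 a1 /alt2; values.
by move=> ?; lra.
Qed.

(** If [s] vanishes at [y], the vectors [A 4] and [A 0] lie in both kernels. There d([al 1]) is
    -V_2, whereas d([be 1]) is 0 because [be 0] kills both vectors. *)
Lemma special_s_neq0 : V 0 1 != 0 -> s y != 0.
Proof.
apply: contra_neq => s0.
have [a4 _] := invV12 (X := A 4) (Y := A 0) ltac:(vanish) ltac:(vanish) ltac:(vanish) ltac:(vanish).
have [b4 _] := invW12 (X := A 4) (Y := A 0) ltac:(vanish) ltac:(values; rewrite ?s0; ring)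
  ltac:(vanish) ltac:(values; rewrite ?s0; ring).
move: b4; rewrite dbe1 a4 /alt2; values.
by move=> ?; lra.
Qed.

(** The same argument with [al 3] and the vectors [A 2], [A 0]. *)
Lemma special_t_neq0 : V 0 1 != 0 -> t y != 0.
Proof.
apply: contra_neq => t0.
have a2 := invV3 (X := A 2) (Y := A 0) ltac:(vanish) ltac:(vanish) ltac:(vanish) ltac:(vanish).
have b2 := invW3 (X := A 2) (Y := A 0) ltac:(vanish) ltac:(values; rewrite ?t0; ring)
  ltac:(vanish) ltac:(values; rewrite ?t0; ring).
move: b2; rewrite dbe3 a2 /alt2; values.
by move=> ?; lra.
Qed.

(** The frame dual to [be], completed by [B0]-free vectors outside index 0. The summand [0 *: A 0]
    only gives the two-term shape of [islin]. *)
Let Fr k := if k == 0 then F0 else if k == 4 then (- 1) *: A 4 + 0 *: A 0 else A k.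

Let beFr j k : be j y (Fr k) = (k == j)%:R.
Proof.
have lF4 i : al i y ((- 1) *: A 4 + 0 *: A 0) = - al i y (A 4).
  by rewrite (lal i Oy); ring.
have bF4 : be 0 y ((- 1) *: A 4 + 0 *: A 0) = 0.
  by rewrite (lbe 0 Oy) !beA; ring.
by move: j k; apply: ord5_ind; apply: ord5_ind; rewrite /Fr /=;
   rewrite ?(be1 _ Oy, be2 _ Oy, be3 _ Oy, be4 _ Oy) ?(linF, be0F, lF4, bF4) ?alA ?beA /=; ring.
Qed.

(** Evaluate [dbe2] on [A 3, F0]. Its left side is -W_3 and d([al 2]) gives V_3. The two trace
    relations give d([be 0]) on [A 3, F0] the same value as d([al 0]) on [A 3, A 0], which enters
    d([al 0]) on [A 3, F0] with the opposite sign; the correction in [F0] leaves 2 t. *)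
Lemma special_W3 : W 1 0 = - V 1 0 - 2 * s y * t y.
Proof.
have ta := trace_relation oO Oy sal lal dal0 dal4 alA.
have tb := trace_relation oO Oy sbe lbe dbe0 dbe4 beFr.
have e2 := dbe2 (X := A 3) (Y := A 2) ltac:(vanish) ltac:(vanish).
have eF := dbe2 (X := A 3) (Y := F0) ltac:(vanish) ltac:(vanish).
have [_ aF] := invV12 (X := A 3) (Y := F0) ltac:(vanish) ltac:(vanish) ltac:(vanish) ltac:(vanish).
have [_ bF] := invW12 (X := A 3) (Y := F0) ltac:(vanish) ltac:(vanish) ltac:(vanish) ltac:(vanish).
have a32 := dal0 (X := A 3) (Y := A 2) Oy ltac:(vanish) ltac:(vanish).
have b32 := dbe0 (X := A 3) (Y := A 2) Oy ltac:(vanish) ltac:(vanish).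
(* All [al j] kill [B0], so this value of d([al 0]) is 0. *)
have a3B := dal0 (X := A 3) (Y := B0) Oy ltac:(vanish) (alB0 0).
have a34 := dal0 (X := A 3) (Y := A 4) Oy ltac:(vanish) ltac:(vanish).
have lin : islin (dcf (al 0) y (A 3)).
  apply: dcf_islin => [v|]; first exact: smooth_diff (sal 0 v) Oy.
  by apply: filterS nearO => z Oz; exact: lal.
have aF0 : dcf (al 0) y (A 3) F0 = dcf (al 0) y (A 3) B0 - dcf (al 0) y (A 3) (A 0)
    + 2 * t y * dcf (al 0) y (A 3) (A 4).
  rewrite /F0 !lin.
  by move: (dcf _ _ _ _) (dcf _ _ _ _) (dcf _ _ _ _) => *; ring.
move: tb; rewrite /Fr /= dbe1.
move: e2 eF aF bF a32 b32 a3B a34 ta aF0; rewrite /alt2 !alB0; values.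
repeat match goal with |- context [dcf ?w ?z ?X ?Y] => move: (dcf w z X Y) => ? end.
move=> e2 eF aF bF a32 b32 a3B a34 ta aF0 tb; move: eF.
rewrite aF0 tb e2 a32 b32 ta a3B a34 aF bF => ?; lra.
Qed.

Lemma special_det : \det W = - \det V + 2 * s y * t y * V 0 1.
Proof.
have [w0 w1] := special_W12; have w3 := special_W3; have w4 := special_W4.
have e1 : fintype.lift 0 (0 : 'I_1) = 1 :> 'I_2 by exact: val_inj.
have e2 : fintype.lift 1 (0 : 'I_1) = 0 :> 'I_2 by exact: val_inj.
have det2 (X : 'M[R]_2) : \det X = X 0 0 * X 1 1 - X 0 1 * X 1 0.
  rewrite (expand_det_row _ 0) !big_ord_recl big_ord0 /cofactor !det_mx11 !mxE /=.
  by rewrite e1 e2 expr0 expr1; ring.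
by rewrite !det2 w0 w1 w3 w4; ring.
Qed.

Lemma special_det_sum : (V 0 1 = 0 -> \det W = - \det V) /\
  (V 0 1 <> 0 -> \det V + \det W <> 0).
Proof.
rewrite special_det; split=> [->|/eqP V0]; first by rewrite mulr0 addr0.
rewrite addrA subrr add0r; apply/eqP.
by rewrite !mulf_neq0 ?special_s_neq0 ?special_t_neq0 // pnatr_eq0.
Qed.

End SpecialRelations.

(** * Dual frames from the independence condition *)

Section Independence.
Variables (R : realType) (n : nat).

Lemma dual_frame m (g : 'I_m -> 'rV[R]_n -> R) (v : 'M[R]_(m, n)) :
  (forall j, islin (g j)) -> \det (\matrix_(i, j) g j (row i v)) != 0 ->
  exists E : 'I_m -> 'rV[R]_n, forall j k, g j (E k) = (k == j)%:R.
Proof.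
move=> lg; set C := \matrix_(i, j) _; rewrite -unitfE -unitmxE => uC.
exists (fun k => row k (invmx C *m v)) => j k.
rewrite row_mul mulmx_sum_row islin_sum //.
transitivity ((invmx C *m C) k j); last by rewrite mulVmx // mxE.
by rewrite mxE; apply: eq_bigr => l _; rewrite islinZ // !mxE.
Qed.

(** Starting from a 1 x 1 determinant, [wedge_det] rewrites the iterated wedge as a 6 x 6
    determinant; indexing [g] by [nat] lets one family serve all sizes. *)
Lemma wedge6_frame (g : nat -> 'rV[R]_n -> R) : (forall j, islin (g j)) ->
  (exists v, wedge (wedge (wedge (wedge (wedge (g 0%N) (g 1%N)) (g 2%N)) (g 3%N))
                     (g 4%N)) (g 5%N) v <> 0) ->
  exists E : nat -> 'rV[R]_n,
    forall j k, (j < 6)%N -> (k < 6)%N -> g j (E k) = (k == j)%:R.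
Proof.
move=> lg [v].
have E1 : g 0%N = (fun u : 'M[R]_(1, n) => \det (\matrix_(i, j < 1) g j (row i u))).
  by apply/funext => u; rewrite det_mx11 mxE row_id.
have E2 : wedge (g 0%N) (g 1%N) = fun u : 'M[R]_(2, n) => \det (\matrix_(i, j < 2) g j (row i u)).
  by rewrite {1}E1; apply/funext => u; exact: (@wedge_det R n 1 g u).
rewrite E2.
have E3 : wedge (fun u : 'M[R]_(2, n) => \det (\matrix_(i, j < 2) g j (row i u))) (g 2%N) =
   fun u : 'M[R]_(3, n) => \det (\matrix_(i, j < 3) g j (row i u)).
  by apply/funext => u; exact: (@wedge_det R n 2 g u).
rewrite E3.
have E4 : wedge (fun u : 'M[R]_(3, n) => \det (\matrix_(i, j < 3) g j (row i u))) (g 3%N) =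
   fun u : 'M[R]_(4, n) => \det (\matrix_(i, j < 4) g j (row i u)).
  by apply/funext => u; exact: (@wedge_det R n 3 g u).
rewrite E4.
have E5 : wedge (fun u : 'M[R]_(4, n) => \det (\matrix_(i, j < 4) g j (row i u))) (g 4%N) =
   fun u : 'M[R]_(5, n) => \det (\matrix_(i, j < 5) g j (row i u)).
  by apply/funext => u; exact: (@wedge_det R n 4 g u).
rewrite E5 (@wedge_det R n 5 g v) => /eqP dv.
have [E dE] := @dual_frame 6 (fun j => g j) v (fun j => lg j) dv.
exists (fun k => E (inord k)) => j k j6 k6.
have := dE (inord j) (inord k); rewrite inordK // => ->.
by rewrite -(inj_eq val_inj) /= !inordK.
Qed.

End Independence.

(** * From a 1-refined lifting to the relations at a point *)

Section Special.
Variables (R : realType) (M Mb : manifold R 5) (I : graded_set M) (Ib : graded_set Mb).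
Variables (N : manifold R 6) (phi : N -> (M * Mb)%type).
Hypotheses (hI : euler_lagrange I) (hIb : euler_lagrange Ib).
Hypotheses (hB : backlund I Ib phi) (hS : special I Ib phi).
Variables (W : set N) (L : lift M Mb N) (q : N).
Hypotheses (hL : lifting1 I Ib phi W L) (Wq : W q).

Let pi : N -> M := fst \o phi.
Let pib : N -> Mb := snd \o phi.

Lemma special_invariants : exists V Vb : 'M[R]_2,
  [/\ V_at I (pi q) (lift_u L q) V 0, V_at Ib (pib q) (lift_ub L q) Vb 0,
      V 0 1 = 0 -> \det Vb = - \det V
    & V 0 1 <> 0 -> \det V + \det Vb <> 0].
Proof.
have [[sp spb _ _ _] _ _] := hB.
have [[oW [su sub [ss st] _ _] lW] l1] := hL.
have mu1 r : W r -> lift_mu L r = 1 by have [_ mu] := hS; exact: mu hL.1 r.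
(* With mu = 1, the condition that eps mu^2 differs from 1 excludes eps = 1. *)
have epsN r : W r -> lift_eps L r = -1.
  move=> Wr; have [[_ _ _ e1 ne] _ _] := lW r Wr.
  case: e1 => // e1.
  by case: ne; rewrite e1 mu1 // expr1n mulr1.
have Gu r : W r -> G1 I (pi r) (lift_u L r) by move=> /lW[[]].
have Gub r : W r -> G1 Ib (pib r) (lift_ub L r) by move=> /lW[[]].
pose a := chart_at q; have aq : mdom a q by exact: mem_chart_at.
pose i := chart_at (pi q); have iq : mdom i (pi q) by exact: mem_chart_at.
pose ib := chart_at (pib q); have ibq : mdom ib (pib q) by exact: mem_chart_at.
pose O := img a (W `&` (pi @^-1` mdom i `&` pib @^-1` mdom ib)).
have oO : open O.
  apply: img_open; apply: openI => //; apply: openI.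
    by apply: open_comp; [move=> ? _; exact: sp.1|exact: mdom_open].
  by apply: open_comp; [move=> ? _; exact: spb.1|exact: mdom_open].
pose y := mcrd a q; have Oy : O y by exact: mem_img.
have yE : minv a y = q by rewrite /y mcrdK.
have Oi z : O z -> img a (W `&` pi @^-1` mdom i) z.
  by move=> [r [ar [Wr [ir _]]] <-]; exact: mem_img.
have Oib z : O z -> img a (W `&` pib @^-1` mdom ib) z.
  by move=> [r [ar [Wr [_ ir]]] <-]; exact: mem_img.
pose al := coframe_pullback pi (lift_u L) a i.
pose be := coframe_pullback pib (lift_ub L) a ib.
have alE z j v : O z -> lift_alpha phi L (minv a z) j a v = al j z v.
  by move=> /Oi; exact: (pullback_chart sp oW Gu).
have beE z j v : O z -> lift_beta phi L (minv a z) j a v = be j z v.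
  by move=> /Oib; exact: (pullback_chart spb oW Gub).
(* Positions 1 and 3 hold s_2 and t_4. With mu = 1 and eps = -1 the locus gives t_2 = s_2 and s_4 =
   -t_4, so these two functions describe the whole lifting relation. *)
pose s z := lift_s L (minv a z) 0 1; pose t z := lift_t L (minv a z) 0 3.
have rel z v : O z -> [/\ be 1 z v = al 1 z v,
    be 2 z v = al 2 z v + s z * (al 0 z v + be 0 z v), be 3 z v = al 3 z v
  & be 4 z v = - al 4 z v + t z * (be 0 z v - al 0 z v)].
  move=> Oz; have /imgP[_ [[Wz _] [az _]]] := Oz.
  have [_ /(_ a az) [j1 j2 j3 j4] _] := lW _ Wz.
  have [[s0 t0] [s2 t2] s3 t1] := l1 _ Wz.
  move: (j1 v) (j2 v) (j3 v) (j4 v).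
  rewrite s0 t0 s2 t2 s3 t1 mu1 // epsN // !alE // !beE // -/(s z) -/(t z).
  rewrite invr1 expr1n.
  move: (al _ _ _) (al _ _ _) (al _ _ _) (al _ _ _) (al _ _ _) (be _ _ _) (be _ _ _)
    (be _ _ _) (be _ _ _) (be _ _ _) (s z) (t z) => *.
  by split; lra.
have sal j v : smooth_on O ((al j)^~ v).
  exact: smooth_sub Oi (coframe_pullback_smooth sp oW su Gu a i j v).
have sbe j v : smooth_on O ((be j)^~ v).
  exact: smooth_sub Oib (coframe_pullback_smooth spb oW sub Gub a ib j v).
have lal j z : O z -> islin (al j z).
  by move=> /Oi Oz; exact: (coframe_pullback_islin sp Gu j Oz).
have lbe j z : O z -> islin (be j z).
  by move=> /Oib Oz; exact: (coframe_pullback_islin spb Gub j Oz).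
have nE z : O z -> W (minv a z) /\ mdom a (minv a z) /\ mdom i (pi (minv a z))
    /\ mdom ib (pib (minv a z)) /\ mcrd a (minv a z) = z.
  by move=> /imgP[_ [[Wz [iz ibz]] [az zE]]].
have dal0 z X Y : O z -> al 0 z X = 0 -> al 0 z Y = 0 ->
    dcf (al 0) z X Y = alt2 (al 1 z) (al 2 z) X Y + alt2 (al 3 z) (al 4 z) X Y.
  move=> /nE[Wz [az [iz [_ zE]]]].
  by have := pullback_d0 sp oW su Gu Wz az iz; rewrite zE; exact.
have dbe0 z X Y : O z -> be 0 z X = 0 -> be 0 z Y = 0 ->
    dcf (be 0) z X Y = alt2 (be 1 z) (be 2 z) X Y + alt2 (be 3 z) (be 4 z) X Y.
  move=> /nE[Wz [az [_ [iz zE]]]].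
  by have := pullback_d0 spb oW sub Gub Wz az iz; rewrite zE; exact.
have p3 : paired 3 4 1 2 by right.
have in34 : (4 : 'I_5) \in [:: 3; 4] by rewrite !inE.
have dal4 := pullback_da sp oW su Gu Wq aq iq p3 in34.
have dbe4 := pullback_da spb oW sub Gub Wq aq ibq p3 in34.
have [V [S2 [VV i12 i3]]] := pullback_invariants sp oW su Gu Wq aq iq.
have [Vb [Sb2 [VVb ib12 ib3]]] := pullback_invariants spb oW sub Gub Wq aq ibq.
have S20 : S2 = 0 := hI.2 _ _ _ _ VV; have Sb20 : Sb2 = 0 := hIb.2 _ _ _ _ VVb.
subst S2 Sb2; exists V, Vb.
have ds : differentiable s y.
  have sS : smooth_on (img a W) (lift_s L \o minv a) by exact: ss.
  apply: (smooth_diff (A := img a W)); last exact: mem_img.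
  by apply: smooth_coord => //; exact: img_open.
have [E dE] : exists E : nat -> 'rV[R]_6, forall j k, (j < 6)%N -> (k < 6)%N ->
    nth (fun=> 0) [:: al 1 y; al 2 y; al 3 y; al 4 y; al 0 y; be 0 y] j (E k) = (k == j)%:R.
  apply: wedge6_frame => [j|].
    move: j => [|[|[|[|[|[|j]]]]]] /=; rewrite ?nth_nil; try exact: lal; try exact: lbe.
    by move=> ? ? ? ?; rewrite !mulr0 addr0.
  have [_ _ /(_ a aq)] := lW q Wq; rewrite -yE /=.
  have eA j : lift_alpha phi L (minv a y) j a = al j y by apply/funext => v; exact: alE.
  have eB j : lift_beta phi L (minv a y) j a = be j y by apply/funext => v; exact: beE.
  by rewrite !eA eB.
(* The independence condition lists [al 0] fifth, at position 4; this reindexing restores the order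
   0, 1, 2, 3, 4. The remaining vector [E 5] is dual to [be 0]. *)
pose A (k : 'I_5) := E (nth 0%N [:: 4; 0; 1; 2; 3]%N k).
have dA l k : (l < 6)%N ->
    nth (fun=> 0) [:: al 1 y; al 2 y; al 3 y; al 4 y; al 0 y; be 0 y] l (A k) =
    (nth 0%N [:: 4; 0; 1; 2; 3]%N k == l)%:R.
  by move=> l6; rewrite dE //; move: k; apply: ord5_ind.
have alA j k : al j y (A k) = (k == j)%:R.
  move: j; apply: ord5_ind; [move: (dA 4%N k isT)|move: (dA 0%N k isT)|
    move: (dA 1%N k isT)|move: (dA 2%N k isT)|move: (dA 3%N k isT)];
  by rewrite /= => ->; move: k; apply: ord5_ind.
have alB j : al j y (E 5%N) = 0.
  by move: j; apply: ord5_ind; [move: (dE 4%N 5%N isT isT)|move: (dE 0%N 5%N isT isT)|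
    move: (dE 1%N 5%N isT isT)|move: (dE 2%N 5%N isT isT)|move: (dE 3%N 5%N isT isT)].
have beA k : be 0 y (A k) = 0.
  by move: (dA 5%N k isT); rewrite /= => ->; move: k; apply: ord5_ind.
have beB : be 0 y (E 5%N) = 1 by move: (dE 5%N 5%N isT isT).
have r1 z v (Oz : O z) : be 1 z v = al 1 z v by have [] := rel z v Oz.
have r2 z v (Oz : O z) : be 2 z v = al 2 z v + s z * (al 0 z v + be 0 z v).
  by have [] := rel z v Oz.
have r3 z v (Oz : O z) : be 3 z v = al 3 z v by have [] := rel z v Oz.
have r4 z v (Oz : O z) : be 4 z v = - al 4 z v + t z * (be 0 z v - al 0 z v).
  by have [] := rel z v Oz.
have z0 k l : (0 : 'M[R]_2) k l = 0 by rewrite mxE.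
have iV X Y X1 X2 Y1 Y2 := i12 X Y X1 X2 Y1 Y2.
have iV3 X Y X1 X2 Y1 Y2 := i3 X Y X1 X2 Y1 Y2.
have iW X Y X1 X2 Y1 Y2 := ib12 X Y X1 X2 Y1 Y2.
have iW3 X Y X1 X2 Y1 Y2 := ib3 X Y X1 X2 Y1 Y2.
rewrite !z0 in iV iV3 iW iW3.
do [setoid_rewrite addr0 in iV]; do [setoid_rewrite addr0 in iW].
do [setoid_rewrite sub0r in iV3]; do [setoid_rewrite sub0r in iW3].
do [setoid_rewrite subr0 in iV3]; do [setoid_rewrite subr0 in iW3].
have [det0 det1] := special_det_sum oO Oy sal sbe lal lbe dal0 dbe0 dal4 dbe4 ds r1 r2 r3 r4
  iV iV3 iW iW3 alA alB beA beB.
by split.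
Qed.

End Special.

Theorem proposition5p2 (R : realType) (M Mb : manifold R 5)
    (I : graded_set M) (Ib : graded_set Mb)
    (hI : euler_lagrange I) (hIb : euler_lagrange Ib)
    (cI : has_class I) (cIb : has_class Ib) :
  ((exists (N : manifold R 6) (phi : N -> (M * Mb)%type),
      backlund I Ib phi /\ type_I I Ib phi) ->
   (positive I /\ negative Ib) \/ (negative I /\ positive Ib)) /\
  ((exists (N : manifold R 6) (phi : N -> (M * Mb)%type),
      backlund I Ib phi /\ type_III I Ib phi) ->
   ~ (degenerate I /\ degenerate Ib)).
Proof.
split=> [[N [phi [hB [hS [[W [L [[q Wq] hL]]] type]]]]]
        |[N [phi [hB [hS [[W [L [[q Wq] hL]]] type]]]]]].
  have [V [Vb [VV VVb det0 _]]] := special_invariants hI hIb hB hS hL Wq.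
  have [V2 detV V0] := type W L hL q Wq V 0 VV.
  have detVb := det0 V2; rewrite -detV in V0.
  (* The value at one point suffices: [det V] is nonzero and [det Vb] is its opposite, so all
     combinations of classes except opposite signs are contradictory. *)
  case: cI => [pI|nI|dI]; last by case: V0; exact: dI VV.
  - left; split=> //; have dV := pI _ _ _ _ VV.
    case: cIb => [pIb|//|dIb].
      by have := pIb _ _ _ _ VVb; rewrite detVb oppr_gt0 ltNge ltW.
    by case: V0; apply: oppr_inj; rewrite oppr0 -detVb; exact: dIb VVb.
  - right; split=> //; have dV := nI _ _ _ _ VV.
    case: cIb => [//|nIb|dIb].
      by have := nIb _ _ _ _ VVb; rewrite detVb oppr_lt0 ltNge ltW.
    by case: V0; apply: oppr_inj; rewrite oppr0 -detVb; exact: dIb VVb.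
have [V [Vb [VV VVb _ det1]]] := special_invariants hI hIb hB hS hL Wq.
move=> [dI dIb]; apply: (det1 (type W L hL q Wq V 0 VV)).
by rewrite (dI _ _ _ _ VV) (dIb _ _ _ _ VVb) addr0.
Qed.
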